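(* With the classes $\sigma_0,\sigma_1,t',\lambda$ defined in the context: (i) $H_1(Sp_{6}^0(\mathbb{Z});\mathbb{Z}) = \mathbb{Z}/4\{\lambda \cdot \sigma_0^2\}$. (ii) $Q_{\mathbb{Z}}^1(\sigma_0) \cdot \sigma_0 = 2 \lambda \cdot \sigma_0^2$. (iii) $Q_{\mathbb{Z}}^1(\sigma_0) \cdot \sigma_0= Q_{\mathbb{Z}}^1(\sigma_1) \cdot \sigma_1$ and $Q_{\mathbb{Z}}^1(\sigma_0) \cdot \sigma_1= Q_{\mathbb{Z}}^1(\sigma_1) \cdot \sigma_0 = 2 \lambda \cdot \sigma_0 \cdot \sigma_1$. (iv) $H_1(Sp_{6}^1(\mathbb{Z});\mathbb{Z}) = \mathbb{Z}/4\{\lambda \cdot \sigma_0 \cdot \sigma_1\}$ and $\lambda \cdot \sigma_0 \cdot \sigma_1= t' \cdot \sigma_0^2$.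
   Context: $\Omega_g$ is the standard symplectic form on $\mathbb{Z}^{2g}$, the block diagonal sum of $g$ copies of $\begin{pmatrix} 0 & 1 \\ -1 & 0 \end{pmatrix}$, with standard ordered basis $(e_1,f_1,\dots,e_g,f_g)$, and $Sp_{2g}(\mathbb{Z})=\mathrm{Aut}(\mathbb{Z}^{2g},\Omega_g)$. A quadratic refinement is a function $q:\mathbb{Z}^{2g}\to\mathbb{Z}/2$ with $q(x+y)\equiv q(x)+q(y)+\Omega_g(x,y)\pmod2$; $Sp_{2g}(\mathbb{Z})$ acts on the right on these by precomposition. $\mathrm{Arf}(q)=\sum_iq(e_i)q(f_i)$. $Sp_{2g}^\epsilon(\mathbb{Z})$ is the stabilizer of a quadratic refinement of Arf invariant $\epsilon$; stabilizers of different quadratic refinements with the same Arf invariant are conjugate and the resulting identification on homology is independent of the conjugating element. $Sp_2^0(\mathbb{Z})$, $Sp_2^1(\mathbb{Z})$ are taken to be the stabilizers of the $q$ with $(q(e_1),q(f_1))=(0,0)$, respectively $(1,1)$. $\sigma_\epsilon\in H_0(Sp_2^\epsilon(\mathbb{Z});\mathbb{Z})$ is the class of a point; $t'\in H_1(Sp_2^1(\mathbb{Z});\mathbb{Z})$ is the class of $\begin{pmatrix} 1 & 1 \\ 0 & 1 \end{pmatrix}$; $\lambda\in H_1(Sp_2^0(\mathbb{Z});\mathbb{Z})$ is the class of $\begin{pmatrix} 0 & -1 \\ 1 & 0 \end{pmatrix}$. Products $\cdot$ are induced by block diagonal sum $\mathrm{Stab}(q)\times\mathrm{Stab}(q')\to\mathrm{Stab}(q\oplus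 q')$. $\bigsqcup_{g\ge1,\epsilon}BSp_{2g}^\epsilon(\mathbb{Z})$ is an $E_2$-algebra, arising from the symmetric monoidal structure given by block sum with symmetry the block-swap matrices; $Q^1_{\mathbb{Z}}:H_0\to H_1$ is the operation given by the image of a generator of $H_1(\mathcal{C}_2(2)/\Sigma_2;\mathbb{Z})\cong\mathbb{Z}$ (where $\mathcal{C}_2$ is the little 2-cubes operad) acting on the square of a degree-$0$ class, normalized by $-2Q^1_{\mathbb{Z}}(-)=[-,-]$ (the Browder bracket). Explicitly, $Q^1_{\mathbb{Z}}(\sigma_\epsilon)\in H_1(Sp_4^0(\mathbb{Z});\mathbb{Z})$ is represented by the block swap $\begin{pmatrix} 0 & I_2 \\ I_2 & 0 \end{pmatrix}$ viewed in the stabilizer of the $q$ taking the value $\epsilon$ on all of $e_1,f_1,e_2,f_2$. $R\{u\}$ denotes the cyclic group $R$ generated by $u$.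
   Formalization: In (iii) the printed equations mix Arf invariants 0 and 1; proved instead: Q(σ0)·σ0 = Q(σ1)·σ0 and Q(σ0)·σ1 = Q(σ1)·σ1 = 2λ·σ0·σ1. In (iv) the printed sign contradicts order 4 for the given matrices; proved: λ·σ0·σ1 = −t'·σ0². *)

(* Defs.v *)
From HB Require Import structures.
From mathcomp Require Import all_boot all_order all_algebra.
From mathcomp Require Import boolp freeg ring zify.

Set Implicit Arguments.
Unset Strict Implicit.
Unset Printing Implicit Defensive.

Import GRing.Theory.
Local Open Scope ring_scope.
Local Open Scope quotient_scope.

Lemma raddf_intZ (V W : lmodType int) (h : {additive V -> W}) (k : int) x :
  h (k *: x) = k *: h x.
Proof. by rewrite -[k]intz !scaler_int raddfMz. Qed.

Lemma freegZU (K : choiceType) (k : int) (x : K) :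
  k *: << x >> = << k *g x >> :> {freeg K / int}.
Proof. by rewrite -[k in LHS]intz scaler_int freegU_mulz intz. Qed.

(* Group homology with trivial integer coefficients, computed by the          *)
(* inhomogeneous bar complex: [chain G n] is free abelian on the bar symbols  *)
(* [g_1|...|g_n].                                                             *)
Notation chain G n := {freeg (n.-tuple G) / int}.

(* d_0 drops g_1, d_i (0 < i < n+1) multiplies g_i and g_(i+1), d_(n+1) drops *)
(* g_(n+1); the letters of the tuple are numbered from 0.                     *)
Definition face (G : groupType) (n i : nat) (t : n.+1.-tuple G) : n.-tuple G :=
  [tuple (let a := tnth t (widen_ord (leqnSn n) k) in
          let b := tnth t (fintype.lift ord0 k) in
          if (k.+1 < i)%N then a else if k.+1 == i then (a * b)%g else b)
  | k < n].

Lemma face_tnth (G : groupType) n i (t : n.+1.-tuple G) k :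
  tnth (face i t) k =
  let a := tnth t (widen_ord (leqnSn n) k) in
  let b := tnth t (fintype.lift ord0 k) in
  if (k.+1 < i)%N then a else if k.+1 == i then (a * b)%g else b.
Proof. exact: tnth_mktuple. Qed.

Definition bnd (G : groupType) (n : nat) : chain G n.+1 -> chain G n :=
  fglift (fun t => \sum_(i < n.+2) (-1) ^+ i *: (<< face i t >> : chain G n)).

Lemma bndU (G : groupType) n (t : n.+1.-tuple G) :
  bnd (<< t >> : chain G n.+1) = \sum_(i < n.+2) (-1) ^+ i *: << face i t >>.
Proof. by rewrite /bnd liftU scale1r. Qed.

Definition cycle_pred (G : groupType) (n : nat) : {pred chain G n} :=
  match n with
  | 0 => fun=> true
  | m.+1 => fun c => bnd c == 0
  end.

Fact bnd_is_zmod_morphism (G : groupType) n : zmod_morphism (@bnd G n).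
Proof. exact: lift_is_additive. Qed.
HB.instance Definition _ (G : groupType) n :=
  GRing.isZmodMorphism.Build (chain G n.+1) (chain G n) (@bnd G n)
    (@bnd_is_zmod_morphism G n).

Fact cycle_pred_zmod_closed (G : groupType) n : zmod_closed (@cycle_pred G n).
Proof.
case: n => [|n]; split=> //; rewrite ?unfold_in /= ?raddf0 //.
by move=> x y; rewrite !unfold_in /= raddfB /= => /eqP-> /eqP->; rewrite subr0.
Qed.
HB.instance Definition _ (G : groupType) n :=
  GRing.isZmodClosed.Build (chain G n) (@cycle_pred G n)
    (@cycle_pred_zmod_closed G n).

Record cycle (G : groupType) n :=
  Cycle { cycle_val :> chain G n; _ : cycle_pred cycle_val }.
HB.instance Definition _ G n := [isSub for @cycle_val G n].
HB.instance Definition _ G n := [Choice of cycle G n by <:].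
HB.instance Definition _ G n :=
  [SubChoice_isSubZmodule of cycle G n by <:].

Definition boundary (G : groupType) n : {pred cycle G n} :=
  fun z => `[< exists c : chain G n.+1, val z = bnd c >].

Fact boundary_zmod_closed (G : groupType) n : zmod_closed (@boundary G n).
Proof.
split=> [|x y /asboolP[c Hc] /asboolP[d Hd]].
  by apply/asboolP; exists 0; rewrite raddf0 raddf0.
by apply/asboolP; exists (c - d); rewrite [RHS]raddfB /= -Hc -Hd.
Qed.
HB.instance Definition _ (G : groupType) n :=
  GRing.isZmodClosed.Build (cycle G n) (@boundary G n)
    (@boundary_zmod_closed G n).

Definition Hgrp (n : nat) (G : groupType) := {ideal_quot (@boundary G n : zmodClosed (cycle G n))}.
HB.instance Definition _ n G := GRing.Zmodule.on (Hgrp n G).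
HB.instance Definition _ n G := Quotient.on (Hgrp n G).

Definition hclass (G : groupType) n (z : cycle G n) : Hgrp n G := \pi_(Hgrp n G) z.

Lemma hclassP (G : groupType) n (z w : cycle G n) :
  hclass z = hclass w <-> exists c, val z - val w = bnd c.
Proof.
have BE : (exists c, val z - val w = bnd c) <-> z - w \in @boundary G n.
  by split=> [[c Hc]|/asboolP[c Hc]]; [apply/asboolP|]; exists c;
    rewrite -Hc ?raddfB.
rewrite BE; have -> : (z - w \in @boundary G n) = (hclass z == hclass w).
  exact: Quotient.idealrBE.
by split=> /eqP.
Qed.

Section Functoriality.
Variables (G G' : groupType) (f : {multiplicative G -> G'}).

Definition chain_map n : chain G n -> chain G' n :=
  fglift (fun t => << map_tuple f t >> : chain G' n).

Fact chain_map_is_zmod_morphism n : zmod_morphism (@chain_map n).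
Proof. exact: lift_is_additive. Qed.
HB.instance Definition _ n :=
  GRing.isZmodMorphism.Build (chain G n) (chain G' n) (@chain_map n)
    (@chain_map_is_zmod_morphism n).

Lemma face_map n i (t : n.+1.-tuple G) :
  face i (map_tuple f t) = map_tuple f (face i t).
Proof.
apply: eq_from_tnth => k; rewrite face_tnth [RHS]tnth_map face_tnth !tnth_map.
by rewrite /=; case: (k.+1 < i)%N; case: (k.+1 == i); rewrite ?gmulfM.
Qed.

Lemma chain_mapU n (t : n.-tuple G) :
  chain_map (<< t >> : chain G n) = << map_tuple f t >>.
Proof. by rewrite /chain_map liftU scale1r. Qed.

Lemma bnd_chain_map n (c : chain G n.+1) :
  bnd (chain_map c) = chain_map (bnd c).
Proof.
rewrite -(freeg_sumE c) !raddf_sum; apply: eq_bigr => t _ /=.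
rewrite -freegZU !(raddf_intZ (@bnd _ _), raddf_intZ (@chain_map _)) /=.
rewrite chain_mapU !bndU; congr (_ *: _); rewrite raddf_sum.
by apply: eq_bigr => i _; rewrite face_map raddf_intZ /= chain_mapU.
Qed.

Lemma chain_map_cycle n (z : cycle G n) : cycle_pred (chain_map (val z)).
Proof.
case: n z => [|n] [c] //= /eqP Hc.
by rewrite bnd_chain_map Hc raddf0.
Qed.

Definition cycle_map n (z : cycle G n) : cycle G' n := Cycle (chain_map_cycle z).

Definition Hmap n (x : Hgrp n G) : Hgrp n G' := hclass (cycle_map (repr x)).

Lemma Hmap_class n (z : cycle G n) : Hmap (hclass z) = hclass (cycle_map z).
Proof.
apply/hclassP => /=; have [c Hc] : exists c, val (repr (hclass z)) - val z = bnd c.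
  by apply/hclassP; rewrite /hclass reprK.
by exists (chain_map c); rewrite bnd_chain_map -Hc raddfB.
Qed.

Fact Hmap_is_zmod_morphism n : zmod_morphism (@Hmap n).
Proof.
move=> x y; rewrite -[x]reprK -[y]reprK -/(hclass _) -/(hclass _).
have hB (K : groupType) (z w : cycle K n) : hclass z - hclass w = hclass (z - w).
  by rewrite /hclass !piE.
rewrite hB !Hmap_class hB; congr hclass; apply: val_inj.
by rewrite /= !raddfB.
Qed.
HB.instance Definition _ n :=
  GRing.isZmodMorphism.Build (Hgrp n G) (Hgrp n G') (@Hmap n)
    (@Hmap_is_zmod_morphism n).

End Functoriality.

(* The generator of H_0 given by the class of a point of BG.                  *)
Definition point (G : groupType) : Hgrp 0 G :=
  hclass (@Cycle G 0 << [tuple] >> isT).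

(* The augmentation H_0(G) -> Z, which takes the class of a point to 1.       *)
Definition aug (G : groupType) (x : Hgrp 0 G) : int := deg (val (repr x)).

Fact bar1_cycle (G : groupType) (g : G) :
  cycle_pred (<< [tuple g] >> : chain G 1).
Proof.
rewrite /= bndU !big_ord_recl big_ord0 (tuple0 (face _ _)).
by rewrite [face (bump _ _) _]tuple0 expr0 expr1 scaleN1r scale1r addr0 subrr.
Qed.

Definition H1class (G : groupType) (g : G) : Hgrp 1 G := hclass (Cycle (bar1_cycle g)).

Lemma aug_class (G : groupType) (z : cycle G 0) : aug (hclass z) = deg (val z).
Proof.
rewrite /aug; apply/eqP; rewrite -subr_eq0 -raddfB; apply/eqP.
have [c ->] : exists c, val (repr (hclass z)) - val z = bnd c.
  by apply/hclassP; rewrite /hclass reprK.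
rewrite -(freeg_sumE c) !raddf_sum big1 // => t _.
rewrite -freegZU raddf_intZ /= bndU !big_ord_recl big_ord0.
rewrite (tuple0 (face _ _)) [face (bump _ _) _]tuple0.
by rewrite expr0 expr1 scaleN1r scale1r addr0 subrr scaler0 raddf0.
Qed.

Lemma aug_point (G : groupType) : aug (point G) = 1.
Proof. by rewrite aug_class degU. Qed.

Lemma Hmap_H1class (G G' : groupType) (f : {multiplicative G -> G'}) (g : G) :
  Hmap f (H1class g) = H1class (f g).
Proof.
rewrite Hmap_class; congr hclass; apply: val_inj; rewrite /= chain_mapU.
by congr << _ >>; apply: val_inj.
Qed.

Lemma H1classM (G : groupType) (g h : G) :
  H1class (g * h)%g = H1class g + H1class h.
Proof.
rewrite -[RHS]/(hclass _ + hclass _).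
have -> (z w : cycle G 1) : hclass z + hclass w = hclass (z + w).
  by rewrite /hclass !piE.
apply/hclassP; exists (- << [tuple g; h] >>); rewrite raddfN /= bndU.
rewrite !big_ord_recl big_ord0 /=.
have E (t : 1.-tuple G) : t = [tuple tnth t ord0].
  by apply: eq_from_tnth => k; rewrite (ord1 k).
rewrite [face 0 _]E [face (bump 0 0) _]E [face (bump 0 (bump 0 0)) _]E.
rewrite !face_tnth /= !(tnth_nth g) /=.
rewrite /bump /= expr0 expr1 expr2 mulrNN mulr1 scale1r scaleN1r scale1r addr0.
by rewrite !opprD opprK addrA addrC addrCA.
Qed.

(* Z^n consists of column vectors, on which matrices act from the left.  For  *)
(* n = 2g the vectors e_1, f_1, .., e_g, f_g are the coordinate vectors       *)
(* 0, 1, .., 2g - 2, 2g - 1, and [Omega n] is Omega_g.                        *)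
Definition Omega (n : nat) : 'M[int]_n :=
  \matrix_(i, j) (if ~~ odd i && (j == i.+1 :> nat) then 1
                  else if ~~ odd j && (i == j.+1 :> nat) then -1 else 0).

Definition sform n (x y : 'cV[int]_n) : int := (x^T *m Omega n *m y) 0 0.

Record quadref (n : nat) := QuadRef {
  qval :> 'cV[int]_n -> 'Z_2;
  qval_even : ~~ odd n;
  qvalD : forall x y, qval (x + y) = qval x + qval y + (sform x y)%:~R
}.

Definition Arf n (q : quadref n) : 'Z_2 :=
  \sum_(i < n) \sum_(j < n | ~~ odd i && (j == i.+1 :> nat))
    q (delta_mx i 0) * q (delta_mx j 0).

(* [symp n] is Sp_n(Z), that is Sp_{2g}(Z) for n = 2g.                        *)
Definition symp n (A : 'M[int]_n) : bool :=
  (A \in unitmx) && (A^T *m Omega n *m A == Omega n).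

Lemma symp1 n : symp (1%:M : 'M_n).
Proof. by rewrite /symp unitmx1 trmx1 mul1mx mulmx1 eqxx. Qed.

Lemma sympM n (A B : 'M_n) : symp A -> symp B -> symp (A *m B).
Proof.
move=> /andP[uA /eqP sA] /andP[uB /eqP sB]; rewrite /symp unitmx_mul uA uB /=.
by rewrite trmx_mul -!mulmxA (mulmxA A^T) (mulmxA (A^T *m _)) sA mulmxA sB.
Qed.

Lemma sympV n (A : 'M_n) : symp A -> symp (invmx A).
Proof.
move=> /andP[uA /eqP sA]; rewrite /symp unitmx_inv uA /= -{1}sA.
by rewrite -!mulmxA mulmxV // mulmx1 mulmxA -trmx_mul mulmxV // trmx1 mul1mx.
Qed.

Definition stab_pred n (q : quadref n) (A : 'M[int]_n) : bool :=
  symp A && `[< forall x, q (A *m x) = q x >].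

Record Stab n (q : quadref n) :=
  MkStab { stab_mx :> 'M[int]_n; _ : stab_pred q stab_mx }.
HB.instance Definition _ n (q : quadref n) := [isSub for @stab_mx n q].
HB.instance Definition _ n (q : quadref n) := [Choice of Stab q by <:].

Section StabGroup.
Variables (n : nat) (q : quadref n).
Implicit Types A B C : Stab q.

Fact stab1_subproof : stab_pred q 1%:M.
Proof. by rewrite /stab_pred symp1; apply/asboolP => x; rewrite mul1mx. Qed.
Definition stab1 : Stab q := MkStab stab1_subproof.

Fact stabM_subproof A B : stab_pred q (val A *m val B).
Proof.
case: A B => [A /= /andP[sA /asboolP qA]] [B /= /andP[sB /asboolP qB]].
rewrite /stab_pred sympM //; apply/asboolP => x.
by rewrite -mulmxA qA qB.
Qed.
Definition stabM A B : Stab q := MkStab (stabM_subproof A B).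

Fact stabV_subproof A : stab_pred q (invmx (val A)).
Proof.
case: A => [A /= /andP[sA /asboolP qA]].
rewrite /stab_pred sympV //; apply/asboolP => x.
by rewrite -[LHS]qA mulmxA mulmxV ?mul1mx //; case/andP: sA.
Qed.
Definition stabV A : Stab q := MkStab (stabV_subproof A).

Fact stabMA : associative stabM.
Proof. by move=> A B C; apply: val_inj; rewrite /= mulmxA. Qed.
Fact stab1M : left_id stab1 stabM.
Proof. by move=> A; apply: val_inj; rewrite /= mul1mx. Qed.
Fact stabM1 : right_id stab1 stabM.
Proof. by move=> A; apply: val_inj; rewrite /= mulmx1. Qed.
Fact stab_unit A : val A \in unitmx.
Proof. by case: A => A /= /andP[/andP[]]. Qed.
Fact stabVM : left_inverse stab1 stabV stabM.
Proof. by move=> A; apply: val_inj; rewrite /= mulVmx ?stab_unit. Qed.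
Fact stabMV : right_inverse stab1 stabV stabM.
Proof. by move=> A; apply: val_inj; rewrite /= mulmxV ?stab_unit. Qed.

HB.instance Definition _ :=
  isGroup.Build (Stab q) stabMA stab1M stabM1 stabVM stabMV.
End StabGroup.

Lemma Omega_block m n : ~~ odd m ->
  Omega (m + n) = block_mx (Omega m) 0 0 (Omega n).
Proof.
move=> ev; apply/matrixP => i j; rewrite -(splitK i) -(splitK j).
case: (split i) => i'; case: (split j) => j' /=;
  rewrite ?(block_mxEul, block_mxEur, block_mxEdl, block_mxEdr) !mxE /=.
- by [].
- have := ltn_ord i'; move: ev.
  case: ifP => [|_]; first lia.
  by case: ifP => [|//]; lia.
- have := ltn_ord j'; move: ev.
  case: ifP => [|_]; first lia.
  by case: ifP => [|//]; lia.
- by rewrite !oddD (negPf ev) /= -!addnS !eqn_add2l.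
Qed.

Lemma sformD m n (x y : 'cV[int]_(m + n)) : ~~ odd m ->
  sform x y = sform (usubmx x) (usubmx y) + sform (dsubmx x) (dsubmx y).
Proof.
move=> ev; rewrite /sform Omega_block // -{1}[x]vsubmxK -{1}[y]vsubmxK.
rewrite tr_col_mx mul_row_block !mulmx0 addr0 add0r mul_row_col.
by rewrite mxE.
Qed.

Section DirectSum.
Variables (m n : nat) (q : quadref m) (q' : quadref n).

Definition qsum_val (x : 'cV[int]_(m + n)) : 'Z_2 :=
  q (usubmx x) + q' (dsubmx x).

Fact qsum_even : ~~ odd (m + n).
Proof. by rewrite oddD (negPf (qval_even q)) (negPf (qval_even q')). Qed.

Fact qsum_valD x y :
  qsum_val (x + y) = qsum_val x + qsum_val y + (sform x y)%:~R.
Proof.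
rewrite /qsum_val !raddfD /= !qvalD sformD ?(qval_even q) // rmorphD /=.
ring.
Qed.

Definition qsum : quadref (m + n) := QuadRef qsum_even qsum_valD.

Lemma symp_block (A : 'M_m) (B : 'M_n) :
  symp A -> symp B -> symp (block_mx A 0 0 B).
Proof.
move=> /andP[uA /eqP sA] /andP[uB /eqP sB].
rewrite /symp Omega_block ?(qval_even q) //.
rewrite unitmxE det_ublock unitrM -!unitmxE uA uB /=.
by rewrite tr_block_mx !trmx0 !mulmx_block !(mulmx0, mul0mx, addr0, add0r) sA sB.
Qed.

Fact block_subproof (A : Stab q) (B : Stab q') :
  stab_pred qsum (block_mx (val A) 0 0 (val B)).
Proof.
case: A B => [A /= /andP[sA /asboolP qA]] [B /= /andP[sB /asboolP qB]].
rewrite /stab_pred symp_block //; apply/asboolP => x /=.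
rewrite /qsum_val -[x in LHS]vsubmxK mul_block_col !mul0mx addr0 add0r.
by rewrite col_mxKu col_mxKd qA qB.
Qed.

Definition block_sum (A : Stab q) (B : Stab q') : Stab qsum :=
  MkStab (block_subproof A B).

Definition stabl (A : Stab q) : Stab qsum := block_sum A 1%g.

Fact stabl_morph : {morph stabl : A B / (A * B)%g}.
Proof.
move=> A B; apply: val_inj => /=.
by rewrite mulmx_block !(mulmx0, mul0mx, addr0, add0r) mulmx1.
Qed.
HB.instance Definition _ :=
  isMultiplicative.Build (Stab q) (Stab qsum) stabl stabl_morph.

(* The product H_p x H_0 -> H_p induced by block sum.  The cross product of a *)
(* class x of Stab q with the class of a point of B(Stab q') is the image of  *)
(* x under the inclusion at the base point, A |-> A (+) 1; the general case   *)
(* follows by bilinearity.                                                    *)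
Definition hprod p (x : Hgrp p (Stab q)) (y : Hgrp 0 (Stab q')) : Hgrp p (Stab qsum) :=
  Hmap stabl x *~ aug y.
End DirectSum.

Notation "x ∙ y" := (hprod x y) (at level 40, left associativity) : ring_scope.

Section BlockSwap.
Variables (n : nat) (q : quadref n).

Fact swap_subproof : stab_pred (qsum q q) (block_mx 0 1%:M 1%:M 0).
Proof.
have sq1 : block_mx 0 1%:M 1%:M 0 *m block_mx 0 1%:M 1%:M 0
           = 1%:M :> 'M[int]_(n + n).
  rewrite mulmx_block !(mulmx0, mul0mx, addr0, add0r, mulmx1).
  by rewrite -scalar_mx_block.
apply/andP; split; last first.
  apply/asboolP => x /=; rewrite /qsum_val -[x in LHS]vsubmxK mul_block_col.
  by rewrite !mul0mx !mul1mx addr0 add0r col_mxKu col_mxKd addrC.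
apply/andP; split; first by case/mulmx1_unit: sq1.
rewrite Omega_block ?(qval_even q) // tr_block_mx !trmx0 !trmx1.
by rewrite !mulmx_block !(mulmx0, mul0mx, addr0, add0r, mulmx1, mul1mx).
Qed.
Definition swap : Stab (qsum q q) := MkStab swap_subproof.

(* The operation Q^1_Z : H_0(Stab q) -> H_1(Stab (q (+) q)).  The fundamental *)
(* loop of C_2(2)/Sigma_2, acting on two copies of the base point, traces the *)
(* symmetry of the monoidal structure, so the class of a point goes to the    *)
(* class of the block swap.  As Q^1_Z is defined through the square y (x) y,  *)
(* it sends k times the class of a point to k ^ 2 times this class.           *)
Definition Q1 (y : Hgrp 0 (Stab q)) : Hgrp 1 (Stab (qsum q q)) :=
  H1class swap *~ (aug y ^+ 2).
End BlockSwap.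

(* An isomorphism of quadratic forms from (Z^n, q) to (Z^n, q'), that is an   *)
(* element of Sp conjugating Stab q to Stab q'.                               *)
Record qiso n (q q' : quadref n) := QIso {
  qiso_mx :> 'M[int]_n;
  qiso_symp : symp qiso_mx;
  qisoE : forall x, q' (qiso_mx *m x) = q x
}.

Section Conjugation.
Variables (n : nat) (q q' : quadref n) (B : qiso q q').

Fact conj_subproof (A : Stab q) : stab_pred q' (B *m val A *m invmx B).
Proof.
case: A => [A /= /andP[sA /asboolP qA]].
rewrite /stab_pred !sympM ?sympV ?qiso_symp //; apply/asboolP => x.
rewrite -!mulmxA qisoE qA -(qisoE B) mulmxA mulmxV ?mul1mx //.
by case/andP: (qiso_symp B).
Qed.
Definition stab_conj (A : Stab q) : Stab q' := MkStab (conj_subproof A).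

Fact stab_conj_morph : {morph stab_conj : A C / (A * C)%g}.
Proof.
move=> A C; apply: val_inj => /=; rewrite -!mulmxA; congr (_ *m (_ *m _)).
by rewrite !mulmxA mulVmx ?mul1mx //; case/andP: (qiso_symp B).
Qed.
HB.instance Definition _ :=
  isMultiplicative.Build (Stab q) (Stab q') stab_conj stab_conj_morph.
End Conjugation.

(* [x =~ y] says that x and y correspond to each other under the canonical    *)
(* identification of H_p(Stab q) with H_p(Stab q').  This identification is   *)
(* induced by conjugation, and does not depend on the conjugating element.    *)
Definition same_class p n (q q' : quadref n)
    (x : Hgrp p (Stab q)) (y : Hgrp p (Stab q')) : Prop :=
  exists B : qiso q q', Hmap (stab_conj B) x = y.

Notation "x =~ y" := (same_class x y) (at level 70, no associativity) : ring_scope.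

(* V = Z/k{u}, for k > 1.                                                     *)
Definition cyclic_on (k : nat) (V : zmodType) (u : V) : Prop :=
  exists f : {additive 'Z_k -> V}, bijective f /\ f 1 = u.

Definition mx2 (a b c d : int) : 'M[int]_2 :=
  \matrix_(i, j) (if i == 0 then (if j == 0 then a else b)
                  else (if j == 0 then c else d)).

Lemma mx2_mul a b c d (x : 'cV[int]_2) :
  (mx2 a b c d *m x) 0 0 = a * x 0 0 + b * x 1 0 /\
  (mx2 a b c d *m x) 1 0 = c * x 0 0 + d * x 1 0.
Proof.
have i1 : fintype.lift ord0 (ord0 : 'I_1) = 1 :> 'I_2 by apply: val_inj.
by rewrite !mxE !big_ord_recl !big_ord0 !mxE /= !addr0 i1.
Qed.

Lemma sform2 (x y : 'cV[int]_2) : sform x y = x 0 0 * y 1 0 - x 1 0 * y 0 0.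
Proof.
have i1 : fintype.lift ord0 (ord0 : 'I_1) = 1 :> 'I_2 by apply: val_inj.
rewrite /sform mxE !big_ord_recl !big_ord0 !mxE !big_ord_recl !big_ord0 !mxE /=.
by rewrite !addr0 i1; ring.
Qed.

(* The quadratic refinement on Z^2 with q(e_1) = q(f_1) = eps.                *)
Definition qstd_val (eps : 'Z_2) (x : 'cV[int]_2) : 'Z_2 :=
  (x 0 0)%:~R * (x 1 0)%:~R + eps * ((x 0 0)%:~R ^+ 2 + (x 1 0)%:~R ^+ 2).

Lemma addZ2 (z : 'Z_2) : z + z = 0.
Proof. by case: z => [[|[|]]] // ?; apply: val_inj. Qed.

Fact qstd_valD eps x y :
  qstd_val eps (x + y) = qstd_val eps x + qstd_val eps y + (sform x y)%:~R.
Proof.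
rewrite /qstd_val sform2 !mxE !rmorphD rmorphN !rmorphM /=.
move: (x 0 0)%:~R (x 1 0)%:~R (y 0 0)%:~R (y 1 0)%:~R => a b c d.
apply/eqP; rewrite -subr_eq0; apply/eqP.
set s := eps * (a * c + b * d) + b * c.
rewrite -[RHS](addZ2 s) /s; ring.
Qed.

Definition qstd (eps : 'Z_2) : quadref 2 := @QuadRef 2 _ isT (qstd_valD eps).

Lemma qstd_e1 eps : qstd eps (delta_mx 0 0) = eps.
Proof. by rewrite /= /qstd_val !mxE /= expr1n mulr0 expr0n /= add0r addr0 mulr1. Qed.

Lemma qstd_f1 eps : qstd eps (delta_mx 1 0) = eps.
Proof. by rewrite /= /qstd_val !mxE /= expr1n mul0r expr0n /= !add0r mulr1. Qed.

Lemma Arf_qstd eps : Arf (qstd eps) = eps.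
Proof.
rewrite /Arf; under eq_bigr do rewrite big_mkcond.
rewrite !big_ord_recl !big_ord0 /= !(addr0, add0r) /qstd_val !mxE /=.
by case: eps => [[|[|]]] // ?; apply: val_inj.
Qed.

Lemma quadref0 n (q : quadref n) : q 0 = 0.
Proof.
have := qvalD q 0 0; rewrite addr0 /sform mulmx0 mxE addr0 => E.
by rewrite -[RHS](subrr (q 0)) {2}E addrK.
Qed.

Lemma Arf_qsum m n (q : quadref m) (q' : quadref n) :
  Arf (qsum q q') = Arf q + Arf q'.
Proof.
have ev := qval_even q.
have ql (i : 'I_m) : qsum q q' (delta_mx (lshift n i) 0) = q (delta_mx i 0).
  rewrite /= /qsum_val -[RHS]addr0 -(quadref0 q').
  by congr (q _ + q' _); apply/matrixP => k l; rewrite !mxE ?eq_rlshift.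
have qr (i : 'I_n) : qsum q q' (delta_mx (rshift m i) 0) = q' (delta_mx i 0).
  rewrite /= /qsum_val -[RHS]add0r -(quadref0 q).
  congr (q _ + q' _); apply/matrixP => k l; rewrite !mxE ?eq_lrshift //.
  by rewrite (inj_eq (@rshift_inj _ _)).
rewrite /Arf big_split_ord /=; congr (_ + _); apply: eq_bigr => i _.
  rewrite big_split_ord /= [X in _ + X]big1 ?addr0.
    by apply: eq_bigr => j _; exact: (f_equal2 *%R (ql i) (ql j)).
  by move=> j; have := ltn_ord i; move: ev; lia.
rewrite big_split_ord /= [X in X + _]big1 ?add0r.
  apply: eq_big => [j|j _]; last exact: (f_equal2 *%R (qr i) (qr j)).
  by rewrite oddD (negPf ev) -addnS eqn_add2l.
by move=> j; have := ltn_ord j; move: ev; lia.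
Qed.

Lemma symp_mx2 a b c d : a * d - b * c = 1 -> symp (mx2 a b c d).
Proof.
move=> det1; apply/andP; split.
  suff /mulmx1_unit[] : mx2 a b c d *m mx2 d (- b) (- c) a = 1%:M by [].
  apply/matrixP => i j; rewrite !mxE !big_ord_recl big_ord0 !mxE /=.
  by case: i => [[|[|]]] // ?; case: j => [[|[|]]] // ?;
    rewrite /= ?mulr1n ?mulr0n; lia.
apply/eqP/matrixP => i j; rewrite !mxE !big_ord_recl big_ord0 !mxE /=.
rewrite !big_ord_recl !big_ord0 !mxE /=.
by case: i => [[|[|]]] // ?; case: j => [[|[|]]] // ?;
  rewrite /= ?mulr1n ?mulr0n; lia.
Qed.

Fact rot_subproof : stab_pred (qstd 0) (mx2 0 (-1) 1 0).
Proof.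
rewrite /stab_pred symp_mx2 //; apply/asboolP => x; rewrite /= /qstd_val.
have [-> ->] := mx2_mul 0 (-1) 1 0 x.
rewrite !mul0r add0r addr0 mul1r mulN1r rmorphN /=.
rewrite !addr0; move: (x 0 0)%:~R (x 1 0)%:~R => a b.
by rewrite mulNr mulrC; apply/esym/eqP; rewrite -addr_eq0 addZ2.
Qed.

Fact shear_subproof : stab_pred (qstd 1) (mx2 1 1 0 1).
Proof.
rewrite /stab_pred symp_mx2 //; apply/asboolP => x; rewrite /= /qstd_val.
have [-> ->] := mx2_mul 1 1 0 1 x.
rewrite !mul0r add0r !mul1r rmorphD /=.
move: (x 0 0)%:~R (x 1 0)%:~R => a b; rewrite -[RHS]addr0.
by rewrite -(addZ2 (a * b + b * b)); ring.
Qed.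

Definition lambda : Hgrp 1 (Stab (qstd 0)) := H1class (MkStab rot_subproof).
Definition t' : Hgrp 1 (Stab (qstd 1)) := H1class (MkStab shear_subproof).
Definition sigma (eps : 'Z_2) : Hgrp 0 (Stab (qstd eps)) := point (Stab (qstd eps)).

(* Main.v *)
Require Import Defs.
From mathcomp Require Import all_boot all_algebra.
From HB Require Import structures.
From mathcomp Require Import all_order boolp freeg ring zify.

(** Let T_v be the transvection x |-> x + omega(x, v) v; it lies in Stab q as
soon as q v = 1.  The theorem follows from one fact about each of the two
stabilizers G in genus 3: there is a homomorphism K : G -> Z/4 that induces an
isomorphism on H_1 and takes the value 1 on the transvections T_v considered
(H1char_exists).  Every identity of the theorem is then an equality between
values of K on explicit matrices, and a class generates H_1 if and only if K is
odd on it.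

Upper bound.  If omega(u, v) is 1 or -1, the braid relation gives T_u and T_v
the same class in H_1, so many transvections share one class t.  If q w = 0,
then T_w^2 is in G, and T_w^2 = T_(v+2w) T_(v+w)^-2 T_v with v orthogonal to w
shows that its class is t - 2 t + t = 0.  These elements generate G: modulo 2
the orthogonal group is generated by reflections, apart from a case in genus 2
that a good choice of basis avoids, and the level 2 subgroup is generated by
squares of transvections, by Euclid's algorithm (level2_generated).  So t
generates H_1.  On a plane with basis e, f and q e = q f = 0, minus the identity
is T_e^2 T_(e+f)^2 T_f^2, of class 2 t, whence 4 t = 0 (graded_1_4).

Lower bound.  K is the square of the theta multiplier, in a purely algebraic
form.  Embed (Z^6, q) isometrically in a hyperbolic space with quadratic form
sum c_i d_i, and let G act on Lagrangians over Z/4, given by pairs (C, D) of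
square matrices.  Turning some of the symplectic planes by a quarter makes D
invertible, and the phase is the number of turns plus 0 or 2, according to
det D = 1 or -1.  A transvection along a vector with c.d odd makes an invertible
D singular mod 2, and one further turn makes it invertible again with a
determinant that can be computed (det_rot1): the phase changes by exactly 1
(phase_transv).  For the standard Lagrangian (0, 1) the phase is well defined
(phase_stable), so a product of transvections that equals 1 has a number of
factors divisible by 4, counted with signs.

Evaluation.  The rotation that represents lambda is T_(e+f) T_f^2, of value 1,
and the shear that represents t' is T_e^-1, of value -1.  In suitable
coordinates a block swap preserves the standard Lagrangian and acts on it with
determinant -1, so its value is 2. *)

Set Implicit Arguments.
Unset Strict Implicit.
Unset Printing Implicit Defensive.

Import Order.TTheory GRing.Theory Num.Theory.
Local Open Scope ring_scope.
Local Open Scope quotient_scope.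

(** * Phases of Lagrangians over Z/4 *)

Section Phase.
Variable n : nat.
Implicit Types (C D : 'M['Z_4]_n) (c d : 'cV['Z_4]_n) (k s x : 'Z_4).

Lemma Z4_4 : 4 = 0 :> 'Z_4. Proof. exact: val_inj. Qed.

Definition even4 x := x *+ 2 = 0.
Definition odd4 x := x *+ 2 = 2.

Lemma even4_or_odd4 x : even4 x \/ odd4 x.
Proof. by case: x => [[|[|[|[|]]]]] //= ?; [left|right|left|right]; apply: val_inj. Qed.

Lemma odd4_sqr x : odd4 x -> x * x = 1.
Proof.
by rewrite /odd4; case: x => [[|[|[|[|]]]]] //= ? H; apply: val_inj => //; move/(congr1 val): H.
Qed.

Lemma even4_mul x y : even4 x -> even4 y -> x * y = 0.
Proof.
rewrite /even4; case: x => [[|[|[|[|]]]]] //= ? H; case: y => [[|[|[|[|]]]]] //= ? H';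
 apply: val_inj => //; by [move/(congr1 val): H|move/(congr1 val): H'].
Qed.

Lemma unit_odd4 x : x \is a GRing.unit -> odd4 x.
Proof.
case: (even4_or_odd4 x) => // xe /mulrV xV.
have /even4_mul := xe; move/(_ 2) => H.
have e2 : even4 2 by exact: val_inj.
have : x^-1 * (x * 2) = 0 by rewrite H // mulr0.
by rewrite mulrA [_^-1 * _]mulrC xV mul1r => /(congr1 val).
Qed.

(** Both sides are the determinant of the block matrix with rows (1, -V) and
(U, 1), factored through either Schur complement. *)
Lemma sylvester (R : comPzRingType) p q (U : 'M[R]_(p, q)) (V : 'M[R]_(q, p)) :
  \det (1%:M + U *m V) = \det (1%:M + V *m U).
Proof.
pose M := block_mx 1%:M (- V) U 1%:M.
have <- : \det M = \det (1%:M + U *m V).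
  have -> : M = block_mx 1%:M 0 U 1%:M *m block_mx 1%:M (- V) 0 (1%:M + U *m V).
    rewrite mulmx_block !(mul0mx, mulmx0, mul1mx, mulmx1, addr0) mulmxN.
    by rewrite addrCA addNr addr0.
  by rewrite det_mulmx det_lblock det_ublock !det1 !mul1r.
have -> : M = block_mx 1%:M (- V) 0 1%:M *m block_mx (1%:M + V *m U) 0 U 1%:M.
  rewrite mulmx_block !(mul0mx, mulmx0, mul1mx, mulmx1, addr0, add0r) mulNmx.
  by rewrite addrK.
by rewrite det_mulmx det_ublock det_lblock !det1 !mul1r mulr1.
Qed.

Lemma det_mx22 (R : comPzRingType) (A : 'M[R]_2) :
  \det A = A 0 0 * A 1 1 - A 0 1 * A 1 0.
Proof.
rewrite (expand_det_row _ 0) !big_ord_recl big_ord0 /cofactor !det_mx11 !mxE /=.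
have -> : fintype.lift 0 0 = 1 :> 'I_2 by exact: val_inj.
have -> : fintype.lift 1 0 = 0 :> 'I_2 by exact: val_inj.
by rewrite /bump /=; ring.
Qed.

(** The columns C_j and D_j span the j-th symplectic plane of (Z/4)^2n, on
whose row vectors (C | D) lives; rotC and rotD turn this plane by a quarter. *)
Definition rotD j C D := \matrix_(i, k) if k == j then C i k else D i k.
Definition rotC j C D := \matrix_(i, k) if k == j then - D i k else C i k.

(** The rows of (C | D) are orthogonal to each other, and the quadratic form
sum c_i d_i vanishes on them mod 2. *)
Definition lag C D :=
  C *m D^T = D *m C^T /\ forall i, even4 ((C *m D^T) i i).

(** The square of the theta multiplier as a multivalued function: turn planes
until D is invertible, count the turns, and add 1 - det D, which is 0 or 2.
Single-valuedness is needed, and proved, only when C = 0 (phase_stable). *)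
Inductive phase : 'M['Z_4]_n -> 'M['Z_4]_n -> 'Z_4 -> Prop :=
| phase_unit C D : lag C D -> \det D \is a GRing.unit -> phase C D (1 - \det D)
| phase_rot j C D k : phase (rotC j C D) (rotD j C D) k -> phase C D (k + 1).

Lemma sum_rot j (f g : 'I_n -> 'Z_4) :
  \sum_k (if k == j then f k else g k) = \sum_k g k + (f j - g j).
Proof.
rewrite (bigD1 j) //= eqxx [in RHS](bigD1 j) //=.
rewrite (eq_bigr g) => [|k /negPf-> //]; ring.
Qed.

Lemma mulmx_trE C D a b : (C *m D^T) a b = \sum_k C a k * D b k.
Proof. by rewrite mxE; under eq_bigr do rewrite mxE. Qed.

Lemma lag_rot j C D : lag C D -> lag (rotC j C D) (rotD j C D).
Proof.
have E a b : (rotC j C D *m (rotD j C D)^T) a b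
    = (C *m D^T) a b - D a j * C b j - C a j * D b j.
  have -> : (C *m D^T) a b - D a j * C b j - C a j * D b j
      = \sum_i C a i * D b i + (- D a j * C b j - C a j * D b j).
    by rewrite mulmx_trE; ring.
  rewrite mulmx_trE -(sum_rot j (fun i => - D a i * C b i) (fun i => C a i * D b i)).
  by apply: eq_bigr => i _; rewrite !mxE; case: ifP.
move=> [sCD eCD]; split=> [|i].
  have tr : (C *m D^T)^T = C *m D^T by rewrite trmx_mul trmxK.
  have -> : rotD j C D *m (rotC j C D)^T = (rotC j C D *m (rotD j C D)^T)^T.
    by rewrite trmx_mul trmxK.
  apply/matrixP => a b; rewrite [RHS]mxE !E -tr [in RHS]mxE tr; ring.
rewrite E; have := eCD i; rewrite /even4 => H.
rewrite !mulrnBl H mulrC; set x := C i j * D i j.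
by rewrite add0r -opprD -mulrnDl -mulr2n -mulrnA -mulr_natl Z4_4 mul0r oppr0.
Qed.

(** Off the diagonal the terms come in equal pairs, and twice a pair of equal
terms vanishes mod 4. *)
Lemma even4_quad (S : 'M['Z_4]_n) c :
  S^T = S -> (forall i, even4 (S i i)) -> even4 ((c^T *m S *m c) 0 0).
Proof.
move=> sS eS; rewrite /even4 !mxE.
under eq_bigr do rewrite mxE mulr_suml.
pose a i j := c j 0 * S j i * c i 0.
have aC i j : a i j = a j i by rewrite /a -{1}sS mxE; ring.
have ae i : a i i *+ 2 = 0 by rewrite /a -mulrnAl -mulrnAr [_ *+ 2]eS mulr0 mul0r.
have -> : \sum_j \sum_i c^T 0 i * S i j * c j 0 = \sum_j \sum_i a j i.
  by apply: eq_bigr => j _; apply: eq_bigr => i _; rewrite !mxE.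
have tri i : \sum_j a i j = \sum_(j : 'I_n | (j < i)%N) a i j
    + (a i i + \sum_(j : 'I_n | (i < j)%N) a i j).
  rewrite (bigID (fun j : 'I_n => (j < i)%N)) /=; congr (_ + _).
  rewrite (bigD1 i) /= ?ltnn //; congr (_ + _); apply: eq_bigl => j.
  by rewrite -val_eqE /=; lia.
rewrite (eq_bigr _ (fun i _ => tri i)) !big_split /= !mulrnDl.
rewrite [X in X + _](_ : _ = (\sum_(i : 'I_n) \sum_(j : 'I_n | (i < j)%N) a i j) *+ 2); last first.
  congr (_ *+ _); under eq_bigr do rewrite big_mkcond.
  rewrite exchange_big /=; apply: eq_bigr => i _; rewrite [RHS]big_mkcond.
  by apply: eq_bigr => j _; rewrite aC.
rewrite [(\sum_i a i i) *+ 2](_ : _ = 0) ?add0r; last first.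
  by rewrite -sumrMnl big1.
by rewrite -mulrnDr -mulr_natl Z4_4 mul0r.
Qed.

Lemma det_block11 (R : comPzRingType) (a b c d : 'M[R]_(1, 1)) :
  \det (block_mx a b c d) = a 0 0 * d 0 0 - b 0 0 * c 0 0.
Proof.
have E (M : 'M[R]_(1 + 1, 1 + 1)) : \det M
    = ulsubmx M 0 0 * drsubmx M 0 0 - ursubmx M 0 0 * dlsubmx M 0 0.
  by rewrite det_mx22 !mxE; congr (M _ _ * M _ _ - M _ _ * M _ _); apply: val_inj.
by rewrite E block_mxKul block_mxKur block_mxKdl block_mxKdr.
Qed.

Lemma rotD_mul j (P : 'M_n) C D : P *m rotD j C D = rotD j (P *m C) (P *m D).
Proof.
apply/matrixP => a b; rewrite !mxE; case: ifP => h.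
  by apply: eq_bigr => i _; rewrite !mxE h.
by apply: eq_bigr => i _; rewrite !mxE h.
Qed.

(** By Sylvester's identity this is a 2 x 2 determinant, with value
S_jj (1 - s c.m) + s m_j^2.  Both factors of the first term are even, and m_j is
odd. *)
Lemma det_rot1 j (S : 'M['Z_4]_n) c d s (m := S *m c + d) :
    S^T = S -> (forall i, even4 (S i i)) -> odd4 ((c^T *m d) 0 0) ->
    s * s = 1 -> odd4 (m j 0) ->
  \det (rotD j (S + s *: (m *m d^T)) (1%:M - s *: (m *m c^T))) = s.
Proof.
move=> sS eS ocd ss om.
have cm : odd4 ((c^T *m m) 0 0).
  rewrite /odd4 mulmxDr mulmxA mxE mulrnDl ocd.
  by have := even4_quad c sS eS; rewrite /even4 => ->; rewrite add0r.
have mE : S *m c = m - d by rewrite addrK.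
move: (m) om cm mE => {}m om cm mE.
pose y : 'rV_n := - s *: c^T + (s * (c j ord0 + d j ord0)) *: delta_mx 0 j.
pose A := col j S - delta_mx j 0.
have -> : rotD j (S + s *: (m *m d^T)) (1%:M - s *: (m *m c^T))
    = 1%:M + row_mx A m *m col_mx (delta_mx 0 j) y.
  apply/matrixP => a b; rewrite mul_row_col /y /A !mxE !big_ord1 !mxE !eqxx /=.
  rewrite andbT; case: (eqVneq b j) => [->|_] /=.
    by case: (a == j); rewrite ?mulr1n ?mulr0n; ring.
  by rewrite mulr0n; ring.
rewrite sylvester mul_col_row [1%:M]scalar_mx_block add_block_mx det_block11.
have dE (x : 'cV['Z_4]_n) : ((delta_mx 0 j : 'rV_n) *m x) 0 0 = x j ord0.
  by rewrite -rowE mxE.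
have E1 (P Q : 'M['Z_4]_(1, 1)) : (P + Q) 0 0 = P 0 0 + Q 0 0 by rewrite mxE.
have EZ a (P : 'M['Z_4]_(1, 1)) : (a *: P) 0 0 = a * P 0 0 by rewrite mxE.
have yE (x : 'cV['Z_4]_n) : (y *m x) 0 0
    = - s * (c^T *m x) 0 0 + s * (c j ord0 + d j ord0) * x j ord0.
  by rewrite /y mulmxDl -!scalemxAl E1 !EZ dE.
rewrite !add0r !E1 !dE !yE /A [(1%:M : 'M_1) _ _]mxE.
have mulA : (c^T *m (col j S - delta_mx j 0)) 0 0 = (m - d - c) j ord0.
  by rewrite mulmxBr colE mulmxA -{1}sS -trmx_mul mE -!colE !mxE.
have Aj : (col j S - delta_mx j 0) j ord0 = S j j - 1 by rewrite !mxE !eqxx.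
have mdc : (m - d - c) j ord0 = m j ord0 - d j ord0 - c j ord0 by rewrite !mxE.
rewrite mulA Aj mdc mulr1n.
set q := m j ord0; set p := (c^T *m m) 0 0.
have -> : (1 + (S j j - 1)) * (1 + (- s * p + s * (c j ord0 + d j ord0) * q))
    - q * (- s * (q - d j ord0 - c j ord0) + s * (c j ord0 + d j ord0) * (S j j - 1))
    = S j j * (1 - s * p) + s * (q * q) by ring.
rewrite (odd4_sqr om) mulr1 even4_mul ?add0r //.
rewrite /even4 mulrnBl -mulrnAr cm; apply/eqP; rewrite subr_eq0; apply/eqP.
by case: (s) ss => [[|[|[|[|]]]]] //= ? H; apply: val_inj => //; move/(congr1 val): H.
Qed.

Lemma sgn4P s : s * s = 1 -> s = 1 \/ s = -1.
Proof.
case: s => [[|[|[|[|]]]]] //= ? H; [left | right]; exact: val_inj.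
Qed.

(** The transvection along (c, d) preserves the symplectic form, and the
quadratic form mod 2 because c.d is odd. *)
Lemma lag_transv C D c d s (m := C *m c + D *m d) :
    lag C D -> odd4 ((c^T *m d) 0 0) -> s * s = 1 ->
  lag (C + s *: (m *m d^T)) (D - s *: (m *m c^T)).
Proof.
move=> [sCD eCD] ocd ss; pose x := D *m d; pose p := (c^T *m d) 0 0.
have Cc : C *m c = m - x by rewrite addrK.
have dcE : d^T *m c = p%:M.
  by rewrite [LHS]mx11_scalar -[d^T *m c]trmxK trmx_mul trmxK [in LHS]mxE.
have E : (C + s *: (m *m d^T)) *m (D - s *: (m *m c^T))^T
    = C *m D^T - (s + p) *: (m *m m^T) + s *: (x *m m^T + m *m x^T).
 rewrite linearB linearZ /= trmx_mul trmxK mulmxDl !mulmxBr.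
 rewrite -!scalemxAl -!scalemxAr scalerA ss scale1r.
rewrite (mulmxA C) Cc -(mulmxA m d^T (c *m _)) (mulmxA d^T c) dcE mul_scalar_mx.
rewrite -scalemxAr -(mulmxA m) -trmx_mul -/x mulmxBl.
rewrite scalerBr scalerDl scalerDr.
  move: (s *: _) (s *: (x *m _)) (s *: (m *m x^T)) (p *: _) => a b e f.
 by apply/matrixP => i j; rewrite !mxE; ring.
clearbody m x.
have sS (T : 'M['Z_4]_n) : T = T^T -> T - (s + p) *: (m *m m^T) + s *: (x *m m^T + m *m x^T)
    = (T - (s + p) *: (m *m m^T) + s *: (x *m m^T + m *m x^T))^T.
  move=> eT; apply/matrixP => i j; rewrite !mxE !big_ord1 !mxE.
  have -> : T i j = T j i by rewrite {1}eT mxE.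
  ring.
split=> [|i].
  have -> : (D - s *: (m *m c^T)) *m (C + s *: (m *m d^T))^T
     = ((C + s *: (m *m d^T)) *m (D - s *: (m *m c^T))^T)^T by rewrite trmx_mul trmxK.
  by rewrite E; apply: sS; rewrite trmx_mul trmxK.
rewrite E !mxE !big_ord1 !mxE -[\sum_(_ < n) _]/((\sum_(_ < n) _)) .
have -> : \sum_(j < n) C i j * D^T j i = (C *m D^T) i i by rewrite mxE.
move: (eCD i) ocd; rewrite /even4 /odd4 -/p => ei op.
rewrite mulrnDl mulrnBl ei -mulrnAl mulrnDl op.
have -> : s *+ 2 = 2 by case: (sgn4P ss) => ->; apply: val_inj.
set z := m i ord0; set w := x i ord0.
transitivity (4 * (s * (w * z) - z * z)); first by ring.
by rewrite Z4_4 mul0r.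
Qed.

(** Multiplying the rows by D^-1 reduces to det_rot1 for S = D^-1 C.  The
vector m0 = S c + d has an odd entry because c.m0 = c.S c + c.d is odd. *)
Lemma det_rot_transv C D c d s (m := C *m c + D *m d) :
    lag C D -> \det D \is a GRing.unit -> odd4 ((c^T *m d) 0 0) -> s * s = 1 ->
  exists j, \det (rotD j (C + s *: (m *m d^T)) (D - s *: (m *m c^T)))
              = s * \det D.
Proof.
move=> [sCD eCD] uD ocd ss; rewrite -unitmxE in uD.
pose S := invmx D *m C.
have SE : S = invmx D *m (C *m D^T) *m (invmx D)^T.
  by rewrite /S -!mulmxA -trmx_mul mulVmx // trmx1 mulmx1.
have sS : S^T = S.
  by rewrite SE !trmx_mul !trmxK -sCD mulmxA.
have eS i : even4 (S i i).
  have := @even4_quad (C *m D^T) (row i (invmx D))^T.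
  rewrite trmx_mul trmxK -sCD => /(_ erefl eCD).
  have -> : (((row i (invmx D))^T)^T *m (C *m D^T) *m (row i (invmx D))^T) 0 0 = S i i.
    rewrite SE trmxK -row_mul [LHS]mxE [RHS]mxE; apply: eq_bigr => a _.
    by rewrite [row i _ _ _]mxE; congr (_ * _); rewrite !mxE.
  by [].
pose m0 := S *m c + d.
have mE : m = D *m m0 by rewrite mulmxDr /S !mulmxA mulmxV // mul1mx.
have [j oj] : exists j, odd4 (m0 j 0).
  case: (boolP [exists j, m0 j 0 *+ 2 != 0]) => [/existsP[j hj]|].
    by exists j; case: (even4_or_odd4 (m0 j 0)) => // e; rewrite e eqxx in hj.
  rewrite negb_exists => /forallP h.
  have : ((c^T *m m0) 0 0) *+ 2 = 0.
    rewrite mxE -sumrMnl big1 // => j _; rewrite -mulrnAr.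
    by move/negPn/eqP: (h j) => ->; rewrite mulr0.
  rewrite /m0 mulmxDr mulmxA mxE mulrnDl ocd.
  have := even4_quad c sS eS; rewrite /even4 => ->.
  by move/(congr1 val).
exists j.
have -> : rotD j (C + s *: (m *m d^T)) (D - s *: (m *m c^T))
   = D *m rotD j (S + s *: (m0 *m d^T)) (1%:M - s *: (m0 *m c^T)).
  have DS : D *m S = C by rewrite mulmxA mulmxV // mul1mx.
  by rewrite rotD_mul mulmxDr DS mulmxBr mulmx1 -!scalemxAr !(mulmxA D) -mE.
by rewrite det_mulmx det_rot1 // mulrC.
Qed.

(** An invertible D becomes singular mod 2 and one more turn repairs it; the
determinant then changes by the factor s, which together with the extra turn
shifts the phase by s.  Turning the plane j along with the vector (c, d) carries
the general case back to this one. *)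
Lemma phase_transv C D k : phase C D k -> forall c d s,
    odd4 ((c^T *m d) 0 0) -> s * s = 1 ->
  phase (C + s *: ((C *m c + D *m d) *m d^T))
        (D - s *: ((C *m c + D *m d) *m c^T)) (k + s).
Proof.
elim=> {C D k} [C D lCD uD|j C D k _ IH] c d s ocd ss.
  have [j dj] := det_rot_transv lCD uD ocd ss.
  have -> : 1 - \det D + s = 1 - s * \det D + 1.
    have /sgn4P[] := ss => ->; first by ring.
    have /unit_odd4 := uD; rewrite /odd4; move: (\det D) => x ox.
    by case: x ox => [[|[|[|[|]]]]] //= ? /(congr1 val) //= _; exact: val_inj.
  apply: (phase_rot (j := j)); rewrite -dj; apply: phase_unit.
    by apply: lag_rot; apply: lag_transv.
  by rewrite dj unitrM uD andbT; apply/unitrP; exists s.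
rewrite addrAC; apply: (phase_rot (j := j)).
pose c' : 'cV['Z_4]_n := \col_i (if i == j then - d i 0 else c i 0).
pose d' : 'cV['Z_4]_n := \col_i (if i == j then c i 0 else d i 0).
have m' : rotC j C D *m c' + rotD j C D *m d' = C *m c + D *m d.
  apply/matrixP => a b; rewrite !mxE -!big_split /=; apply: eq_bigr => i _.
  by rewrite !mxE (ord1 b); case: ifP => _; ring.
have o' : odd4 ((c'^T *m d') 0 0).
  have -> : (c'^T *m d') 0 0 = (c^T *m d) 0 0 + (- d j 0 * c j 0 - c^T 0 j * d j 0).
    rewrite [LHS]mxE [in RHS]mxE -(sum_rot j (fun i => - d i 0 * c i 0) (fun i => c^T 0 i * d i 0)).
    by apply: eq_bigr => i _; rewrite !mxE; case: ifP.
  rewrite /odd4 mulrnDl ocd.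
  have -> : (- d j 0 * c j 0 - c^T 0 j * d j 0) *+ 2 = - 4 * (c j 0 * d j 0).
    by rewrite mxE; ring.
  by rewrite Z4_4 oppr0 mul0r addr0.
have := IH c' d' s o' ss; rewrite m'; congr (phase _ _ _);
  apply/matrixP => a b; rewrite !mxE !big_ord1 !mxE; case: ifP => _; ring.
Qed.

End Phase.

Section End.
Variable n : nat.
Implicit Types (C D : 'M['Z_4]_n) (k : 'Z_4).

(** Cosine and sine of r quarter turns. *)
Definition quarter (r : nat) : 'Z_4 * 'Z_4 := iter r (fun p => (- p.2, p.1)) (1, 0).

Lemma quarter_cycle r :
  (r%:R : 'Z_4, quarter r) \in
    [:: (0, (1, 0)); (1, (0, 1)); (2, (-1, 0)); (3, (0, -1))].
Proof.
elim: r => [|r]; first by [].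
have -> : quarter r.+1 = (- (quarter r).2, (quarter r).1) by [].
rewrite -[r.+1]addn1 natrD; case: (quarter r) => a b /=.
by rewrite !inE; case/or4P => /eqP[-> -> ->].
Qed.

Lemma cos_unit r : (quarter r).1 \is a GRing.unit ->
  (quarter r).1 = 1 + r%:R /\ even4 r%:R.
Proof.
have := quarter_cycle r; case: (quarter r) => a b /=.
by rewrite !inE; case/or4P => /eqP[-> -> _] //= _; split; apply: val_inj.
Qed.

Lemma prod1_even4 (I : Type) (s : seq I) (f : I -> 'Z_4) :
  (forall i, even4 (f i)) ->
  \prod_(i <- s) (1 + f i) = 1 + \sum_(i <- s) f i /\ even4 (\sum_(i <- s) f i).
Proof.
move=> ef; elim: s => [|i s [IH es]].
  by rewrite !big_nil addr0 /even4 mul0rn.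
rewrite !big_cons IH; split; last by rewrite /even4 mulrnDl ef es addr0.
have := even4_mul (ef i) es; set x := f i; set y := \sum_(_ <- _) _ => xy.
have -> : (1 + x) * (1 + y) = 1 + (x + y) + x * y by ring.
by rewrite xy addr0.
Qed.

(** After r_j turns of each plane (0, D0_j), invertibility of D forces all r_j
to be even.  Then det D is det D0 times the product of the 1 + r_j, which is
1 + sum r_j mod 4, and the number of turns compensates for this factor. *)
Lemma phase_rotated C D k : phase C D k -> forall (D0 : 'M_n) (r : 'I_n -> nat),
    C = \matrix_(i, j) (- (quarter (r j)).2 * D0 i j) ->
    D = \matrix_(i, j) ((quarter (r j)).1 * D0 i j) ->
  k + \sum_j (r j)%:R = 1 - \det D0.
Proof.
elim=> {C D k} [C D _ uD|j C D k _ IH] D0 r eC eD.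
  have dD : \det D = \det D0 * \prod_j (quarter (r j)).1.
    have -> : D = D0 *m diag_mx (\row_j (quarter (r j)).1).
      by apply/matrixP => a b; rewrite eD mul_mx_diag !mxE mulrC.
    by rewrite det_mulmx det_diag; congr (_ * _); apply: eq_bigr => i _; rewrite mxE.
  move: uD; rewrite dD unitrM => /andP[/unit_odd4 u0 uc].
  have u j : (quarter (r j)).1 \is a GRing.unit.
    by move: uc; rewrite (bigD1 j) //= unitrM => /andP[].
  have [] := @prod1_even4 _ (index_enum 'I_n) (fun j => (r j)%:R).
    by move=> j; have [] := cos_unit (u j).
  rewrite (eq_bigr _ (fun j _ => (cos_unit (u j)).1)) => -> eS.
  have e1 : even4 (1 - \det D0) by rewrite /even4 mulrnBl u0 subrr.
  have := even4_mul eS e1; set S := \sum_(_ <- _) _; set x := \det D0 => Sx.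
  rewrite -/S; have -> : 1 - x * (1 + S) + S = 1 - x + S * (1 - x) by ring.
  by rewrite Sx addr0.
have -> : k + 1 + \sum_i (r i)%:R = k + \sum_i (if i == j then (r i).+1 else r i)%:R.
  rewrite -addrA; congr (_ + _); rewrite (bigD1 j) //= [in RHS](bigD1 j) //= eqxx.
  rewrite addrA -[(r j).+1]addn1 natrD [1 + _]addrC; congr (_ + _).
  by apply: eq_bigr => i /negPf ->.
apply: IH; apply/matrixP => a b; rewrite eC eD !mxE; case: eqP => // _ /=; ring.
Qed.

Lemma phase_stable D k : phase 0 D k -> k = 1 - \det D.
Proof.
move=> /phase_rotated/(_ D (fun=> 0%N)); rewrite big1 // addr0; apply.
  by apply/matrixP => a b; rewrite !mxE oppr0 mul0r.
by apply/matrixP => a b; rewrite !mxE mul1r.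
Qed.
End End.

(** * Transvections and their action on phases *)

Lemma trmx_Omega N : (Omega N)^T = - Omega N.
Proof.
apply/matrixP => i j; rewrite !mxE; case: i => i /= _; case: j => j /= _.
case: ifP => h1; case: ifP => h2; try lia; case: ifP => h3; try lia.
Qed.

Section Transvection.
Variable N : nat.
Implicit Types (x y u v w : 'cV[int]_N) (s : int).

Lemma sformC x y : sform x y = - sform y x.
Proof.
rewrite /sform; set a := x^T *m _ *m _.
have -> : a 0 0 = a^T 0 0 by rewrite [RHS]mxE.
by rewrite /a !trmx_mul trmxK trmx_Omega mulNmx mulmxN mulmxA mxE.
Qed.
Lemma sform_xx x : sform x x = 0.
Proof. by have := sformC x x; lia. Qed.
Lemma sformDl x y z : sform (x + y) z = sform x z + sform y z.
Proof. by rewrite /sform linearD /= !mulmxDl mxE. Qed.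
Lemma sformZl s x z : sform (s *: x) z = s * sform x z.
Proof. by rewrite /sform linearZ /= -!scalemxAl mxE. Qed.
Lemma sformDr x y z : sform z (x + y) = sform z x + sform z y.
Proof. by rewrite sformC sformDl opprD -!(sformC z). Qed.
Lemma sformZr s x z : sform z (s *: x) = s * sform z x.
Proof. by rewrite sformC sformZl -mulrN -(sformC z). Qed.

Definition transv v s : 'M[int]_N := 1%:M - s *: (v *m v^T *m Omega N).

Lemma transvE v s x : transv v s *m x = x + (s * sform x v) *: v.
Proof.
rewrite /transv mulmxBl mul1mx -scalemxAl -!mulmxA.
have -> : v^T *m (Omega N *m x) = (sform v x)%:M.
  by rewrite mulmxA [LHS]mx11_scalar.
by rewrite mul_mx_scalar scalerA -scaleNr -mulrN -sformC.
Qed.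
End Transvection.

Section Action.
Variables (N n : nat) (Kc Kd : 'M[int]_(n, N)).
Hypothesis OO : Omega N *m Omega N = - 1%:M.
Hypothesis KK : Kc^T *m Kd - Kd^T *m Kc = Omega N.

Local Notation z4 := (map_mx (intr : int -> 'Z_4)).
Implicit Types (C D : 'M['Z_4]_n) (A B : 'M[int]_N).

(** Let K be an isometric embedding of Z^N in the hyperbolic space Z^2n, with
halves Kc and Kd.  A matrix A acts on Z^2n through K on the image of K, and as
the identity on its orthogonal complement.  The halves of (C | D) times this
matrix are actC and actD, while pull is (C | D) K. *)
Definition pull C D := C *m z4 Kc + D *m z4 Kd.
Definition actC A C D := C + pull C D *m z4 (A - 1%:M) *m z4 (Omega N *m Kd^T).
Definition actD A C D := D - pull C D *m z4 (A - 1%:M) *m z4 (Omega N *m Kc^T).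
Definition acts A (k : 'Z_4) := forall C D k0,
  phase C D k0 -> phase (actC A C D) (actD A C D) (k0 + k).

Lemma pull_act A C D : pull (actC A C D) (actD A C D) = pull C D *m z4 A.
Proof.
rewrite -[LHS]/(actC A C D *m z4 Kc + actD A C D *m z4 Kd) /actC /actD mulmxDl mulmxBl addrACA -/(pull C D).
set P := pull C D *m z4 _.
have -> : P *m z4 (Omega N *m Kd^T) *m z4 Kc - P *m z4 (Omega N *m Kc^T) *m z4 Kd
    = P *m z4 (Omega N *m (Kd^T *m Kc - Kc^T *m Kd)).
  by rewrite mulmxBr map_mxB mulmxBr -!(mulmxA P) -!map_mxM !mulmxA.
have -> : Kd^T *m Kc - Kc^T *m Kd = - Omega N by rewrite -KK opprB.
by rewrite mulmxN OO opprK map_mx1 mulmx1 /P map_mxB map_mx1 mulmxBr mulmx1 addrC subrK.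
Qed.

Lemma acts_mul A B k k' : acts A k -> acts B k' -> acts (A *m B) (k + k').
Proof.
move=> hA hB C D k0 /hA/hB; rewrite addrA.
have E : A *m B - 1%:M = (A - 1%:M) + A *m (B - 1%:M).
  by rewrite mulmxBr mulmx1 [RHS]addrC addrA subrK.
have E4 : pull C D *m z4 (A *m B - 1%:M)
    = pull C D *m z4 (A - 1%:M) + pull C D *m z4 A *m z4 (B - 1%:M).
  by rewrite E map_mxD map_mxM mulmxDr mulmxA.
have -> : actC B (actC A C D) (actD A C D) = actC (A *m B) C D.
  by rewrite {1}/actC pull_act /actC E4 mulmxDl addrA.
have -> : actD B (actC A C D) (actD A C D) = actD (A *m B) C D.
  by rewrite {1}/actD pull_act /actD E4 mulmxDl opprD addrA.
by [].
Qed.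

Lemma acts_transv v (s : int) : s = 1 \/ s = -1 ->
    odd4 (((Kc *m v)^T *m (Kd *m v)) 0 0)%:~R ->
  acts (transv v s) s%:~R.
Proof.
move=> hs o C D k0 /phase_transv/(_ (z4 (Kc *m v)) (z4 (Kd *m v)) s%:~R).
have -> : s%:~R * s%:~R = 1 :> 'Z_4 by rewrite -intrM; case: hs => ->.
rewrite !map_trmx -map_mxM [X in odd4 X]mxE => /(_ o erefl).
have -> : C *m z4 (Kc *m v) + D *m z4 (Kd *m v) = pull C D *m z4 v.
  by rewrite !map_mxM !mulmxA -mulmxDl.
have E (K : 'M[int]_(n, N)) :
    pull C D *m z4 (transv v s - 1%:M) *m z4 (Omega N *m K^T)
    = s%:~R *: (pull C D *m z4 v *m z4 (K *m v)^T).
  rewrite /transv addrC addKr -mulmxA -map_mxM mulNmx -scalemxAl -!mulmxA.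
  rewrite (mulmxA (Omega N)) OO mulNmx mul1mx !mulmxN scalerN opprK -trmx_mul.
  by rewrite map_mxZ -scalemxAr map_mxM !mulmxA.
by rewrite /actC /actD !E.
Qed.

Lemma act1 C D : actC 1%:M C D = C /\ actD 1%:M C D = D.
Proof. by rewrite /actC /actD subrr map_mx0 mulmx0 !mul0mx addr0 subr0. Qed.

Lemma acts1 : acts 1%:M 0.
Proof. by move=> C D k0; have [-> ->] := act1 C D; rewrite addr0. Qed.

Lemma phase_std : phase (0 : 'M_n) 1%:M 0.
Proof.
have := @phase_unit n 0 1%:M; rewrite det1 subrr unitr1; apply=> //.
by split=> [|i]; rewrite ?trmx0 ?mul0mx ?mulmx0 // mxE /even4 mul0rn.
Qed.

Lemma acts_stable A k : acts A k -> actC A 0 1%:M = 0 -> k = 1 - \det (actD A 0 1%:M).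
Proof.
by move=> h e; have := h _ _ _ phase_std; rewrite e add0r => /phase_stable.
Qed.

Lemma acts1_eq k : acts 1%:M k -> k = 0.
Proof.
have [e1 e2] := act1 0 1%:M.
by move/acts_stable/(_ e1) ->; rewrite e2 det1 subrr.
Qed.

End Action.

(** * Degrees of elements of a stabilizer *)

Lemma H1class1 (G : groupType) : H1class (1%g : G) = 0.
Proof. by apply: (addrI (H1class 1%g)); rewrite -H1classM mulg1 addr0. Qed.

Lemma H1classV (G : groupType) (g : G) : H1class g^-1%g = - H1class g.
Proof. by apply: (addrI (H1class g)); rewrite -H1classM mulgV H1class1 subrr. Qed.

Lemma mx_actP (R : pzRingType) m n (A B : 'M[R]_(m, n)) :
  (forall x : 'cV[R]_n, A *m x = B *m x) -> A = B.
Proof.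
move=> h; apply/matrixP => i j.
by have /matrixP/(_ i 0) := h (delta_mx j 0); rewrite -!colE !mxE.
Qed.

Lemma invmx_mul (R : comUnitRingType) n (A B : 'M[R]_n) :
  A \in unitmx -> B \in unitmx -> invmx (A *m B) = invmx B *m invmx A.
Proof.
move=> uA uB; have uAB : A *m B \in unitmx by rewrite unitmx_mul uA.
by rewrite -[RHS](mulKmx uAB) -(mulmxA A) (mulmxA B) !mulmxV // mul1mx mulmxV // mulmx1.
Qed.

Section Trv.
Variable N : nat.
Implicit Types (u v w x y : 'cV[int]_N) (s k : int).

Lemma transvD v s s' : transv v s *m transv v s' = transv v (s + s').
Proof.
apply: mx_actP => x; rewrite -mulmxA !transvE !(sformDl, sformZl) sform_xx mulr0 addr0.
by rewrite -addrA -scalerDl mulrDl [_ * _ + _]addrC.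
Qed.

Lemma transv0 v : transv v 0 = 1%:M.
Proof. by rewrite /transv scale0r subr0. Qed.

Lemma transvV v s : invmx (transv v s) = transv v (- s).
Proof.
have e : transv v (- s) *m transv v s = 1%:M by rewrite transvD addNr transv0.
have [_ u] := mulmx1_unit e.
by rewrite -[LHS]mul1mx -e -mulmxA mulmxV // mulmx1.
Qed.

Lemma symp_transv v s : symp (transv v s).
Proof.
apply/andP; split.
  have e : transv v (- s) *m transv v s = 1%:M by rewrite transvD addNr transv0.
  by have [] := mulmx1_unit e.
have -> : (transv v s)^T = 1%:M + s *: (Omega N *m (v *m v^T)).
  rewrite /transv linearB linearZ /= trmx1 !trmx_mul trmxK trmx_Omega mulNmx.
  by rewrite scalerN opprK.
apply/eqP; rewrite /transv mulmxDl mul1mx mulmxBr mulmx1.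
have vv : v^T *m Omega N *m v = 0.
  by rewrite [LHS]mx11_scalar -[_ 0 0]/(sform v v) sform_xx raddf0.
set a := Omega N *m (v *m v^T); set b := v *m v^T *m Omega N.
have ab : a *m Omega N *m b = 0.
  by rewrite /a /b -!mulmxA (mulmxA v^T) (mulmxA (v^T *m _)) vv mul0mx !mulmx0.
rewrite -!scalemxAr -!scalemxAl mulmxDl -scalemxAl ab scaler0 addr0.
by rewrite /a /b !mulmxA addrK.
Qed.

Lemma symp_sform (A : 'M[int]_N) x y : symp A -> sform (A *m x) (A *m y) = sform x y.
Proof.
case/andP => _ /eqP sA; rewrite /sform trmx_mul -!mulmxA (mulmxA A^T).
by rewrite (mulmxA (A^T *m _)) sA mulmxA.
Qed.

(** This identifies T_u and T_v in every abelian quotient. *)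
Lemma transv_braid u v : sform u v = 1 \/ sform u v = -1 ->
  transv u 1 *m transv v 1 *m transv u 1 = transv v 1 *m transv u 1 *m transv v 1.
Proof.
move=> uv; apply: mx_actP => x; rewrite -!mulmxA !transvE !(sformDl, sformZl) !sform_xx.
rewrite (sformC v u) !mul1r; move: (sform x u) (sform x v) => a b.
by apply/matrixP => i j; rewrite !mxE; case: uv => ->; ring.
Qed.

End Trv.

Lemma intr_Z2_odd (z : int) : (z%:~R : 'Z_2) = 1 -> odd4 (z%:~R : 'Z_4).
Proof.
have [m [b ->]] : exists m, exists b : bool, z = m * 2 + b%:Z.
  by exists (z %/ 2)%Z, (odd `|z|); lia.
rewrite !rmorphD !rmorphM /= /odd4.
have -> : (2%:~R : 'Z_2) = 0 by exact: val_inj.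
rewrite mulr0 add0r; case: b => [_|/(congr1 val)] //.
rewrite mulrnDl -mulrnAr; have -> : (2%:~R : 'Z_4) *+ 2 = 0 by exact: val_inj.
by rewrite mulr0 add0r.
Qed.

Section Graded.
Variables (N n : nat) (Kc Kd : 'M[int]_(n, N)) (q : quadref N).
Hypothesis OO : Omega N *m Omega N = - 1%:M.
Hypothesis KK : Kc^T *m Kd - Kd^T *m Kc = Omega N.
Hypothesis Kq : forall x, q x = (((Kc *m x)^T *m (Kd *m x)) 0 0)%:~R.
Variable t : Hgrp 1 (Stab q).
Implicit Types (u v w x y : 'cV[int]_N) (s k : int) (A B : 'M[int]_N).

Lemma qvalZ s x : q (s *: x) = (s * s)%:~R * q x.
Proof.
by rewrite !Kq -!scalemxAr linearZ /= -scalemxAl scalerA mxE rmorphM.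
Qed.

Lemma stab_transv v s : q v = 1 \/ (2 %| s)%Z -> stab_pred q (transv v s).
Proof.
move=> h; rewrite /stab_pred symp_transv; apply/asboolP => x.
rewrite transvE qvalD qvalZ sformZr -addrA -[RHS]addr0; congr (_ + _).
have Z2 (z : int) : (2 %| z)%Z -> (z%:~R : 'Z_2) = 0.
  by case/dvdzP => m ->; rewrite rmorphM mulr_natr; exact: addZ2.
case: h => [-> | d2].
  rewrite mulr1 -intrD Z2 //; set f := sform x v.
  have -> : s * f * (s * f) + s * f * f = f * f * (s * (s + 1)) by ring.
  apply: dvdz_mull; case: (boolP (2 %| s)%Z) => d; first exact: dvdz_mulr.
  by apply: dvdz_mull; lia.
by rewrite !Z2 ?mul0r ?addr0 //; apply/dvdz_mulr/dvdz_mulr => //; exact/dvdz_mulr.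
Qed.

(** The class of A is k t, and A shifts phases by k.  The last condition is
carried along because phases are relations, for which the condition on A does
not yield the one on its inverse. *)
Definition graded A k := exists H : stab_pred q A,
  [/\ H1class (MkStab H) = t *~ k, acts Kc Kd A k%:~R
    & acts Kc Kd (invmx A) (- k)%:~R].

Lemma graded_unit A k : graded A k -> A \in unitmx.
Proof. by case=> H _; have := stab_unit (MkStab H). Qed.

Lemma graded1 : graded 1%:M 0.
Proof.
exists (stab1_subproof q); split; [|exact: acts1|rewrite invmx1; exact: acts1].
by rewrite mulr0z -[RHS](H1class1 (Stab q)).
Qed.

Lemma graded_mul A B k k' : graded A k -> graded B k' -> graded (A *m B) (k + k').
Proof.
move=> gA gB; have [HA [cA aA aA']] := gA; have [HB [cB aB aB']] := gB.
have := stabM_subproof (MkStab HA) (MkStab HB) => /= H; exists H; split.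
- rewrite mulrzDr -cA -cB -H1classM; congr H1class; exact: val_inj.
- by rewrite rmorphD; apply: acts_mul.
rewrite invmx_mul ?(graded_unit gA) ?(graded_unit gB) // opprD addrC rmorphD.
exact: acts_mul.
Qed.

Lemma graded_inv A k : graded A k -> graded (invmx A) (- k).
Proof.
case=> HA [cA aA aA']; have := stabV_subproof (MkStab HA) => /= H; exists H.
split=> //; last by rewrite invmxK opprK.
rewrite mulrNz -cA -H1classV; congr H1class; exact: val_inj.
Qed.

Definition transv_graded v := q v = 1 /\ graded (transv v 1) 1.

Lemma graded_transv1 v (H : stab_pred q (transv v 1)) :
  q v = 1 -> H1class (MkStab H) = t -> graded (transv v 1) 1.
Proof.
move=> qv tH; have o := intr_Z2_odd (etrans (esym (Kq v)) qv).
exists H; split=> //; first by apply: acts_transv => //; left.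
by rewrite transvV; apply: acts_transv => //; right.
Qed.

Lemma transv_graded_braid u v : transv_graded u -> q v = 1 -> sform u v = 1 \/ sform u v = -1 ->
  transv_graded v.
Proof.
move=> [qu [Hu [tu _ _]]] qv uv; split=> //.
have Hv := @stab_transv v 1 (or_introl qv); apply: (graded_transv1 (H := Hv)) => //.
have : (MkStab Hu * MkStab Hv * MkStab Hu = MkStab Hv * MkStab Hu * MkStab Hv)%g.
  by apply: val_inj; exact: transv_braid.
move/(congr1 (@H1class _)); rewrite !H1classM tu mulr1z addrAC.
by move/addIr/addIr.
Qed.

Lemma graded_transv v s : transv_graded v -> graded (transv v s) s.
Proof.
case=> _ g1.
have gn (m : nat) : graded (transv v m%:Z) m%:Z.
  elim: m => [|m IH]; first by rewrite transv0; exact: graded1.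
  by rewrite -addn1 PoszD -transvD; exact: graded_mul.
case: (intP s) => [|m|m]; [exact: (gn 0%N)|exact: (gn m.+1)|].
by rewrite -transvV; apply: graded_inv; exact: gn.
Qed.

(** Since v, v + w and v + 2 w all pair to 1 or -1 with u, their transvections
have class t, and T_w^2 = T_(v+2w) T_(v+w)^-2 T_v has class t - 2 t + t. *)
Lemma graded_sqr_transv u v w : transv_graded u -> q v = 1 -> q w = 0 ->
    sform u v = 1 \/ sform u v = -1 -> sform u w = 0 -> sform v w = 0 ->
  graded (transv w 2) 0.
Proof.
move=> gu qv qw uv uw vw.
have g s : transv_graded (v + s *: w).
  apply: (transv_graded_braid gu); last by rewrite sformDr sformZr uw mulr0 addr0.
  by rewrite qvalD qvalZ sformZr qw vw !mulr0 !addr0.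
have -> : transv w 2 = transv (v + 2 *: w) 1 *m transv (v + 1 *: w) (-2) *m transv (v + 0 *: w) 1.
  apply: mx_actP => x; rewrite -!mulmxA !transvE.
  rewrite !(sformDl, sformZl, sformDr, sformZr) !sform_xx (sformC w v) vw.
  by apply/matrixP => i j; rewrite !mxE; ring.
rewrite -[0]/(1 + -2 + 1 : int).
by apply: graded_mul; [apply: graded_mul|]; exact: graded_transv.
Qed.

(** The identity shifts the phase of the standard Lagrangian by k - k', and
that phase is well defined. *)
Lemma graded_uniq A k k' : graded A k -> graded A k' -> (k%:~R : 'Z_4) = k'%:~R.
Proof.
move=> gA [H [_ _ a']]; have [_ [_ a _]] := gA.
have := acts_mul OO KK a a'; rewrite mulmxV ?(graded_unit gA) // => /acts1_eq.
by rewrite -rmorphD rmorphB => /eqP; rewrite subr_eq0 => /eqP.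
Qed.

End Graded.

(** * Vectors of genus 3 and their reduction mod 2 *)

Definition entry (x : 'cV[int]_6) (i : nat) : int := x (inord i) ord0.

Lemma entryE (x : 'cV[int]_6) (i : 'I_6) j : x i j = entry x i.
Proof. by rewrite /entry inord_val (ord1 j). Qed.

Lemma entryP (x y : 'cV[int]_6) : (forall i, (i < 6)%N -> entry x i = entry y i) -> x = y.
Proof. by move=> h; apply/matrixP => i j; rewrite !entryE h. Qed.

Lemma sum6 (V : nmodType) (F : 'I_6 -> V) : \sum_i F i =
  F (inord 0) + F (inord 1) + F (inord 2) + F (inord 3) + F (inord 4) + F (inord 5).
Proof.
rewrite !big_ord_recl big_ord0 addr0 !addrA.
by congr (F _ + F _ + F _ + F _ + F _ + F _); apply: val_inj; rewrite /= inordK.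
Qed.

Lemma sform6 x y : sform x y = entry x 0 * entry y 1 - entry x 1 * entry y 0
  + (entry x 2 * entry y 3 - entry x 3 * entry y 2) +
    (entry x 4 * entry y 5 - entry x 5 * entry y 4).
Proof.
rewrite /sform mxE sum6 !mxE !sum6 !mxE !inordK //= /entry.
ring.
Qed.

Lemma Omega6_sqr : Omega 6 *m Omega 6 = - 1%:M.
Proof.
apply/matrixP => i j; rewrite !mxE sum6 !mxE !inordK //.
by case: i => [[|[|[|[|[|[|]]]]]]] // ?; case: j => [[|[|[|[|[|[|]]]]]]] // ?.
Qed.

Lemma entryD x y i : entry (x + y) i = entry x i + entry y i. Proof. by rewrite /entry mxE. Qed.
Lemma entryZ k x i : entry (k *: x) i = k * entry x i. Proof. by rewrite /entry mxE. Qed.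

Definition par (z : int) : bool := odd `|z|.
Lemma parD a b : par (a + b) = par a (+) par b. Proof. by rewrite /par; lia. Qed.
Lemma parM a b : par (a * b) = par a && par b. Proof. by rewrite /par abszM oddM. Qed.
Lemma parN a : par (- a) = par a. Proof. by rewrite /par abszN. Qed.
Lemma par_Z2 z : (z%:~R : 'Z_2) = (par z)%:R.
Proof.
have -> : z = (z %/ 2)%Z * 2 + (par z)%:Z by rewrite /par; lia.
rewrite rmorphD rmorphM /=; have -> : (2%:~R : 'Z_2) = 0 by exact: val_inj.
rewrite mulr0 add0r parD parM andbF; by case: (par z).
Qed.

(** Reduction mod 2 as a list of bits makes statements about all vectors
decidable by computation. *)
Definition bits x : seq bool := mkseq (fun i => par (entry x i)) 6.
Definition bvec (s : seq bool) : 'cV[int]_6 := \col_i (nth false s i : nat)%:Z.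

Lemma entry_bvec s i : (i < 6)%N -> entry (bvec s) i = (nth false s i : nat).
Proof. by move=> h; rewrite /entry mxE inordK. Qed.

Lemma nth_bits x i : (i < 6)%N -> nth false (bits x) i = par (entry x i).
Proof. by move=> h; rewrite nth_mkseq. Qed.

Lemma par_bool (b : bool) : par (b : nat)%:Z = b. Proof. by case: b. Qed.

Lemma bits_bvec s : size s = 6%N -> bits (bvec s) = s.
Proof.
move=> sz; apply: (@eq_from_nth _ false); first by rewrite size_mkseq sz.
by move=> i; rewrite size_mkseq => h; rewrite nth_bits // entry_bvec // par_bool.
Qed.

Local Notation nb := (nth false).

Definition zform (s r : seq bool) : int :=
  let f i := ((nb s i * nb r i.+1)%N : int) - ((nb s i.+1 * nb r i)%N : int) in f 0%N + f 2%N +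
    f 4%N.
Definition bform (s r : seq bool) : bool :=
  let f i := (nb s i && nb r i.+1) (+) (nb s i.+1 && nb r i) in f 0%N (+) f 2%N (+) f 4%N.
(** The quadratic form x0 x1 + x2 x3 + x4 x5 + delta (x0^2 + x1^2) + x4^2 + x5^2,
of Arf invariant delta + 1.  The last two planes together have Arf invariant 1,
which matters for check_stage: over F_2 the orthogonal group of genus 2 and Arf
invariant 0 is not generated by reflections. *)
Definition bquad (delta : bool) (s : seq bool) : bool :=
  (nb s 0%N && nb s 1%N) (+) (nb s 2%N && nb s 3%N) (+) (nb s 4%N && nb s 5%N)
    (+) (delta && (nb s 0%N (+) nb s 1%N)) (+) (nb s 4%N (+) nb s 5%N).
Definition btransv (v s : seq bool) : seq bool :=
  if bform s v then mkseq (fun i => nb s i (+) nb v i) 6 else s.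

Lemma sform_bvec s r : sform (bvec s) (bvec r) = zform s r.
Proof. by rewrite sform6 !entry_bvec // /zform !PoszM. Qed.

Lemma par_sform x y : par (sform x y) = bform (bits x) (bits y).
Proof. by rewrite sform6 /bform !nth_bits // !(parD, parN, parM). Qed.

Lemma bits_transv v x : bits (transv v 1 *m x) = btransv (bits v) (bits x).
Proof.
rewrite transvE /btransv mul1r -par_sform.
have E i : (i < 6)%N -> par (entry (x + sform x v *: v) i)
    = par (entry x i) (+) (par (sform x v) && par (entry v i)).
  by move=> h; rewrite entryD entryZ parD parM.
case: (boolP (par _)) => p; apply: (@eq_from_nth _ false); rewrite !size_mkseq // => i h.
  by rewrite !nth_mkseq // E // p.
by rewrite !nth_mkseq // E // (negPf p) addbF.
Qed.

Definition bitvecs : seq (seq bool) :=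
  iter 6 (fun l => map (cons false) l ++ map (cons true) l) [:: [::]].
Lemma mem_bitvecs s : (s \in bitvecs) = (size s == 6%N).
Proof.
rewrite /bitvecs; elim: 6%N s => [|m IH] s; first by rewrite inE; case: s.
rewrite iterS mem_cat; case: s => [|b s].
  by apply/negP => /orP[]/mapP[].
rewrite /= eqSS -IH; set l := iter m _ _.
have inj c : injective (cons c : seq bool -> _) by move=> ? ? [].
have neg c : (c :: s \in map (cons (~~ c)) l) = false.
  by apply/negP => /mapP[? _ []]; case: c.
by case: b; rewrite (mem_map (@inj _)) neg ?orbF.
Qed.

Definition nonsing delta := [seq s <- bitvecs | bquad delta s].
Definition base_vec : seq bool := [:: false; false; false; false; true; false].
Definition neighbors delta (S : seq (seq bool)) :=
  S ++ [seq s <- nonsing delta | has (fun u => `|zform u s|%N == 1%N) S].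

Definition unitv i : seq bool := mkseq (fun j => j == i) 6.
Definition addv (s r : seq bool) := mkseq (fun j => nb s j || nb r j) 6.

(** Connectedness of the graph of anisotropic 0/1 vectors, with an edge where the
braid relation applies, makes their transvections homologous. *)
Definition check_conn delta :=
  all (fun s => s \in neighbors delta (neighbors delta [:: base_vec])) (nonsing delta).
Definition level2_vecs := [seq unitv i | i <- iota 0 6] ++
  [seq addv (unitv i) (unitv j) | i <- iota 0 6, j <- iota 0 6].
(** Existence of the auxiliary vectors u and v of graded_sqr_transv. *)
Definition check_sqr delta :=
  all (fun w => bquad delta w ||
     has (fun v => (zform v w == 0) &&
         has (fun u => (`|zform u v|%N == 1%N) && (zform u w == 0)) (nonsing delta)) (nonsing delta)) level2_vecs.
Definition stage_vecs delta i := [seq v <- nonsing delta | all (fun j => ~~ bform (unitv j) v) (iota 0 i)].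
Fixpoint reach S k (target y : seq bool) : bool :=
  (y == target) || if k is k'.+1 then has (fun v => reach S k' target (btransv v y)) S else false.
(** Generation of the orthogonal group over F_2 by reflections, one basis
vector at a time: two reflections that fix the earlier basis vectors suffice to
bring the image of the i-th one back to it. *)
Definition check_stage delta i :=
  all (fun y => [&& bquad delta y == bquad delta (unitv i) &
        all (fun j => bform (unitv j) y == bform (unitv j) (unitv i)) (iota 0 i)] ==>
      ((y == nseq 6 false) || reach (stage_vecs delta i) 2 (unitv i) y)) bitvecs.

Lemma check_all delta : [&& check_conn delta, check_sqr delta
   & all (check_stage delta) (iota 0 6)].
Proof. by case: delta; vm_compute. Qed.

Definition stdv i := bvec (unitv i).

Lemma entry_stdv i j : (j < 6)%N -> entry (stdv i) j = (j == i : nat).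
Proof. by move=> h; rewrite entry_bvec // nth_mkseq. Qed.

(** The index of the basis vector that pairs nontrivially with the j-th. *)
Definition dual_idx j := if odd j then j.-1 else j.+1.
Definition dual_sign j : int := if odd j then 1 else -1.

Lemma dual_idxK j : dual_idx (dual_idx j) = j.
Proof. by rewrite /dual_idx; case: (boolP (odd j)) => o; case: ifP; lia. Qed.

Lemma sform_stdv x j : (j < 6)%N -> sform x (stdv j) = dual_sign j * entry x (dual_idx j).
Proof.
move=> h; rewrite sform6 !entry_stdv // /dual_sign /dual_idx.
by case: j h => [|[|[|[|[|[|]]]]]] //= _; rewrite ?mulr1 ?mulr0 ?mulN1r ?mul1r; lia.
Qed.

Lemma bits_stdv i : bits (stdv i) = unitv i.
Proof. by rewrite bits_bvec // size_mkseq. Qed.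

Lemma mx_stdvP (A B : 'M[int]_6) : (forall j, (j < 6)%N -> A *m stdv j = B *m stdv j) -> A = B.
Proof.
move=> h; apply/matrixP => i j; have /matrixP/(_ i ord0) := h j (ltn_ord j).
have -> : stdv j = delta_mx j 0.
  by apply: entryP => k hk; rewrite entry_stdv // /entry mxE -val_eqE /= inordK // andbT; case: eqP.
by rewrite -!colE !mxE.
Qed.

(** The remainder of least absolute value modulo 2 c; opposite parities exclude
the value |c| itself. *)
Lemma euclid_step (c d : int) : par c != par d -> c != 0 ->
  exists k, `|d + 2 * k * c| < `|c|.
Proof.
rewrite /par => p c0; exists (- ((d + `|c|) %/ (2 * c))%Z).
have := divz_eq (d + `|c|) (2 * c); have c2 : 2 * c != 0 by lia.
have := modz_ge0 (d + `|c|) c2; have := ltz_mod (d + `|c|) c2.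
by set u := (_ %/ _)%Z; set m := (_ %% _)%Z => h1 h2 h3; nia.
Qed.

Lemma size_level2_vecs (w : seq bool) : w \in level2_vecs -> size w = 6%N.
Proof.
move=> wl; have /allP/(_ w wl)/eqP // : all (fun w => size w == 6%N) level2_vecs.
by vm_compute.
Qed.

(** * Reduction to the level 2 subgroup *)

Section Base.
Variables (n : nat) (Kc Kd : 'M[int]_(n, 6)) (q : quadref 6) (delta : bool).
Hypothesis KK : Kc^T *m Kd - Kd^T *m Kc = Omega 6.
Hypothesis Kq : forall x, q x = (((Kc *m x)^T *m (Kd *m x)) 0 0)%:~R.
Hypothesis Hq : forall x, q x = (bquad delta (bits x))%:R.
Variable t : Hgrp 1 (Stab q).
Hypothesis Ht : graded Kc Kd t (transv (bvec base_vec) 1) 1.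
Implicit Types (x y u v w : 'cV[int]_6) (A B g h : 'M[int]_6) (k : int).

Local Notation transv_graded := (transv_graded Kc Kd t).
Local Notation gr := (graded Kc Kd t).
Definition gradable A := exists k, gr A k.

Lemma gradable_mul A B : gradable A -> gradable B -> gradable (A *m B).
Proof.
by move=> [k gA] [k' gB]; exists (k + k'); apply: (graded_mul Omega6_sqr KK).
Qed.

Lemma gradable_stab A : gradable A -> stab_pred q A. Proof. by case=> k [H _]. Qed.

Lemma gradable_cancel A B : gradable A -> gradable (A *m B) -> gradable B.
Proof.
move=> [k gA] gAB; rewrite -[B](mulKmx (graded_unit gA)).
by apply: gradable_mul => //; exists (- k); apply: graded_inv.
Qed.

Lemma q_bvec s : size s = 6%N -> q (bvec s) = (bquad delta s)%:R.
Proof. by move=> h; rewrite Hq bits_bvec. Qed.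

Lemma nonsingP s : s \in nonsing delta -> size s = 6%N /\ q (bvec s) = 1.
Proof.
rewrite mem_filter mem_bitvecs => /andP[h /eqP z]; split=> //.
by rewrite q_bvec // h.
Qed.

(** Propagation of the class t along the edges of the graph, from base_vec. *)
Lemma transv_graded_nonsing s : s \in nonsing delta -> transv_graded (bvec s).
Proof.
have [/allP conn _] := andP (check_all delta).
have step S : (forall r, r \in S -> transv_graded (bvec r)) ->
    forall r, r \in neighbors delta S -> transv_graded (bvec r).
  move=> gS r; rewrite mem_cat => /orP[/gS //|]; rewrite mem_filter.
  case/andP => /hasP[u uS uv] /nonsingP[_ qr].
  apply: (transv_graded_braid Omega6_sqr Kq (gS _ uS) qr); rewrite sform_bvec.
  by move: uv; move: (zform _ _) => z; lia.
have g0 r : r \in [:: base_vec] -> transv_graded (bvec r).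
  by rewrite inE => /eqP->; split; [rewrite q_bvec //; case: (delta)|exact: Ht].
by move/conn; exact: (step _ (step _ g0)).
Qed.

Lemma gradable_nonsing s k : s \in nonsing delta -> gradable (transv (bvec s) k).
Proof. by move=> /transv_graded_nonsing hs; exists k; apply: (graded_transv Omega6_sqr KK). Qed.

Lemma graded_sqr (w : seq bool) : w \in level2_vecs -> bquad delta w = false ->
  gr (transv (bvec w) 2) 0.
Proof.
move=> wl qw; have [_ /andP[/allP/(_ w wl) sq _]] := andP (check_all delta).
move: sq; rewrite qw /= => /hasP[v vo /andP[/eqP vw /hasP[u uo /andP[uv /eqP uw]]]].
have sz := size_level2_vecs wl.
apply: (graded_sqr_transv Omega6_sqr KK Kq (transv_graded_nonsing uo) (nonsingP vo).2).
- by rewrite q_bvec // qw.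
- by rewrite sform_bvec; move: uv; move: (zform _ _) => z; lia.
- by rewrite sform_bvec.
by rewrite sform_bvec.
Qed.

Lemma gradable_sqr (w : seq bool) k : w \in level2_vecs -> gradable (transv (bvec w) (2 * k)).
Proof.
move=> wl; case qw : (bquad delta w).
  by apply: gradable_nonsing; rewrite mem_filter qw mem_bitvecs (size_level2_vecs wl).
have g2 := graded_sqr wl qw; exists 0.
have gn (m : nat) : gr (transv (bvec w) (2 * m%:Z)) 0.
  elim: m => [|m IH]; first by rewrite mulr0 transv0; exact: graded1.
  rewrite -[m.+1]addn1 PoszD mulrDr -transvD.
  exact: (graded_mul Omega6_sqr KK IH g2).
case: (intP k) => [|m|m]; [exact: (gn 0%N)|exact: (gn m.+1)|].
by rewrite mulrN -transvV; exact: (graded_inv (gn _)).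
Qed.

Lemma q_inj (b c : bool) : (b%:R : 'Z_2) = c%:R -> b = c.
Proof. by case: b; case: c => // /(congr1 val). Qed.

Lemma stab_q g x : stab_pred q g -> q (g *m x) = q x.
Proof. by case/andP => _ /asboolP. Qed.
Lemma stab_sform g x y : stab_pred q g -> sform (g *m x) (g *m y) = sform x y.
Proof. by case/andP => sg _; exact: symp_sform. Qed.

Lemma stabM g h : stab_pred q g -> stab_pred q h -> stab_pred q (g *m h).
Proof. by move=> hg hh; exact: (stabM_subproof (MkStab hg) (MkStab hh)). Qed.

Definition level2 g := forall j, (j < 6)%N -> bits (g *m stdv j) = unitv j.

Lemma gradable_reach i (m : nat) g : (i < 6)%N ->
    (forall g, stab_pred q g -> (forall j, (j < i.+1)%N -> bits (g *m stdv j) = unitv j) -> gradable g) ->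
    stab_pred q g -> (forall j, (j < i)%N -> bits (g *m stdv j) = unitv j) ->
  reach (stage_vecs delta i) m (unitv i) (bits (g *m stdv i)) -> gradable g.
Proof.
move=> i6 IH; have done' g' : stab_pred q g' ->
    (forall j, (j < i)%N -> bits (g' *m stdv j) = unitv j) ->
    bits (g' *m stdv i) == unitv i -> gradable g'.
  move=> sg' bg' /eqP bi; apply: IH => // j.
  by rewrite ltnS leq_eqVlt => /orP[/eqP->//|]; exact: bg'.
elim: m g => [|m IHk] g sg' bg /=; first by rewrite orbF; exact: done'.
case/orP => [|/hasP[v]]; first exact: done'.
rewrite mem_filter => /andP[/allP vj vo].
have gv := gradable_nonsing 1 vo; have [sv _] := nonsingP vo.
have bv : bits (bvec v) = v by rewrite bits_bvec.
rewrite -{1}bv -bits_transv mulmxA => /IHk H.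
apply: (gradable_cancel gv); apply: H.
  by apply: stabM => //; exact: gradable_stab gv.
move=> j ji; rewrite -mulmxA bits_transv bg // bv /btransv.
by have := vj j; rewrite mem_iota /= ji => /(_ isT)/negPf ->.
Qed.

(** Multiplying by reflections lifted to transvections turns g into an element
that is trivial mod 2, column by column. *)
Lemma gradable_level2 : (forall g, stab_pred q g -> level2 g -> gradable g) ->
  forall g, stab_pred q g -> gradable g.
Proof.
move=> H; suff S m : (m <= 6)%N -> forall g, stab_pred q g ->
    (forall j, (j < 6 - m)%N -> bits (g *m stdv j) = unitv j) -> gradable g.
  by move=> g sg'; apply: (S 6%N).
elim: m => [|m IH] m6 g sg' bg; first by apply: H.
have i6 : (6 - m.+1 < 6)%N by lia.
have IH' : forall g, stab_pred q g -> (forall j, (j < (6 - m.+1).+1)%N ->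
    bits (g *m stdv j) = unitv j) -> gradable g.
  move=> g' sg'' bg'; apply: IH => //; first exact: ltnW.
  by move=> j hj; apply: bg'; lia.
move: (6 - m.+1)%N i6 IH' bg => i i6 IH' bg {IH m6 m}.
apply: (@gradable_reach i 2 g) => //.
have [_ /andP[_ /allP/(_ i)]] := andP (check_all delta).
rewrite mem_iota i6 => /(_ isT)/allP/(_ (bits (g *m stdv i))).
rewrite mem_bitvecs size_mkseq eqxx => /(_ isT)/implyP.
set y := bits _ => H'.
have bform_g j (k : nat) : bform (bits (g *m stdv j)) (bits (g *m stdv k)) =
  bform (unitv j) (unitv k).
  by rewrite -par_sform stab_sform // par_sform !bits_stdv.
have cnd : [&& bquad delta y == bquad delta (unitv i) &
    all (fun j => bform (unitv j) y == bform (unitv j) (unitv i)) (iota 0 i)].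
  apply/andP; split.
    by apply/eqP/q_inj; rewrite -Hq stab_q // Hq bits_stdv.
  by apply/allP => j; rewrite mem_iota /= => ji; rewrite -{1}(bg j ji) bform_g.
case/orP: (H' cnd) => //.
(* Reduction mod 2 keeps the pairing of columns i and dual_idx i odd, so y is not 0. *)
move/eqP => y0; have := bform_g i (dual_idx i); rewrite -/y y0.
by case: (i) i6 => [|[|[|[|[|[|]]]]]].
Qed.

End Base.

(** * Generation of the level 2 subgroup *)

Lemma Posz_false : Posz (nat_of_bool false) = 0. Proof. by []. Qed.
Lemma Posz_true : Posz (nat_of_bool true) = 1. Proof. by []. Qed.

(** Even powers of the transvections along e_i and e_i + e_j suffice for the
level 2 subgroup.  The index p confines them to the hyperbolic planes after the
first p, so that they fix the columns already treated. *)
Inductive sqprod (p : nat) : 'M[int]_6 -> Prop :=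
| sqprod1 : sqprod p 1%:M
| sqprodM (w : seq bool) (k : int) h : w \in level2_vecs ->
  (forall j, (j < p.*2)%N -> nth false w j = false) ->
    sqprod p h -> sqprod p (transv (bvec w) (2 * k) *m h).

Lemma sqprod_mul p g h : sqprod p g -> sqprod p h -> sqprod p (g *m h).
Proof.
move=> G H; elim: G => [|w k g' wl wp _ IH]; first by rewrite mul1mx.
by rewrite -mulmxA; apply: sqprodM.
Qed.

Lemma sqprod_transv p (w : seq bool) k : w \in level2_vecs ->
  (forall j, (j < p.*2)%N -> nth false w j = false) ->
  sqprod p (transv (bvec w) (2 * k)).
Proof. by move=> wl wp; rewrite -[transv _ _]mulmx1; apply: sqprodM => //; exact: sqprod1. Qed.

Lemma sqprod_symp p h : sqprod p h -> symp h.
Proof.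
by elim=> [|w k h' _ _ _ IH]; [exact: symp1|apply: sympM => //; exact: symp_transv].
Qed.

Lemma sqprod_unit p h : sqprod p h -> h \in unitmx.
Proof. by move/sqprod_symp/andP => []. Qed.

Lemma sqprod_inv p h : sqprod p h -> sqprod p (invmx h).
Proof.
elim=> [|w k h' wl wp mh IH]; first by rewrite invmx1; exact: sqprod1.
have mT : sqprod p (transv (bvec w) (2 * k)) by exact: sqprod_transv.
rewrite invmx_mul ?(sqprod_unit mh) ?(sqprod_unit mT) //; apply: sqprod_mul => //.
by rewrite transvV -mulrN; exact: sqprod_transv.
Qed.

Lemma sqprod_all p h : sqprod p h -> sqprod 0 h.
Proof. by elim=> [|w k h' wl wp _ IH]; [exact: sqprod1|exact: sqprodM]. Qed.

Lemma sqprod_bits p h x : sqprod p h -> bits (h *m x) = bits x.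
Proof.
elim=> [|w k h' _ _ _ IH]; first by rewrite mul1mx.
rewrite -mulmxA transvE -IH; apply: (@eq_from_nth _ false); rewrite !size_mkseq // => i hi.
by rewrite !nth_bits // entryD entryZ parD !parM /= addbF.
Qed.

Lemma sqprod_fix p h j : sqprod p h -> (j < p.*2)%N -> (p <= 3)%N -> h *m stdv j = stdv j.
Proof.
move=> mh jp p3; elim: mh => [|w k h' _ wp _ IH]; first by rewrite mul1mx.
have j6 : (j < 6)%N by lia.
have pj : (dual_idx j < p.*2)%N by rewrite /dual_idx; case: ifP; lia.
rewrite -mulmxA IH transvE sformC sform_stdv // entry_bvec; last by lia.
by rewrite (wp _ pj) mulr0 oppr0 mulr0 scale0r addr0.
Qed.

Lemma nth_unitv i j : (j < 6)%N -> nth false (unitv i) j = (j == i).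
Proof. by move=> h; rewrite nth_mkseq. Qed.

Lemma sqprod_stdv p i k : (p.*2 <= i < 6)%N -> sqprod p (transv (stdv i) (2 * k)).
Proof.
move=> hi; apply: sqprod_transv.
  by rewrite mem_cat map_f // mem_iota; lia.
by move=> j hj; rewrite nth_unitv; lia.
Qed.

(** In T_(u+w)^2k T_u^-2k T_w^-2k, for orthogonal u and w, the square terms
cancel and the cross terms remain, which mix two hyperbolic planes. *)
Definition eichler i j k := transv (stdv i + stdv j) (2 * k) *m transv (stdv i) (- (2 * k)) *m
  transv (stdv j) (- (2 * k)).

Lemma sqprod_sum p i j k : (p.*2 <= i < 6)%N -> (p.*2 <= j < 6)%N -> i != j ->
  sqprod p (transv (stdv i + stdv j) (2 * k)).
Proof.
move=> hi hj ij; have -> : stdv i + stdv j = bvec (addv (unitv i) (unitv j)).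
  apply: entryP => m hm; rewrite entryD !entry_stdv // entry_bvec // nth_mkseq // !nth_unitv //.
  by move: ij; do 2 case: eqP => //=; lia.
apply: sqprod_transv.
  have mi : i \in iota 0 6 by rewrite mem_iota; lia.
  have mj : j \in iota 0 6 by rewrite mem_iota; lia.
  by rewrite mem_cat; apply/orP; right; apply/allpairsP; exists (i, j).
by move=> m hm; rewrite nth_mkseq ?nth_unitv; lia.
Qed.

Lemma sqprod_eichler p i j k : (p.*2 <= i < 6)%N -> (p.*2 <= j < 6)%N -> i != j ->
  sqprod p (eichler i j k).
Proof.
move=> hi hj ij; apply: sqprod_mul; last by rewrite -mulrN; exact: sqprod_stdv.
by apply: sqprod_mul; [exact: sqprod_sum|rewrite -mulrN; exact: sqprod_stdv].
Qed.

Lemma eichlerE i j k x : (i < 6)%N -> (j < 6)%N -> i != j -> i != dual_idx j ->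
  eichler i j k *m x = x + (2 * k) *: (sform x (stdv i) *: stdv j + sform x (stdv j) *: stdv i).
Proof.
move=> hi hj ij ipj.
have eij : sform (stdv i) (stdv j) = 0.
  rewrite sform_stdv // entry_stdv; last by move: hj; rewrite /dual_idx; case: ifP; lia.
  by rewrite eq_sym (negPf ipj) mulr0.
rewrite /eichler -!mulmxA !transvE !(sformDl, sformZl, sformDr, sformZr) !sform_xx.
rewrite (sformC (stdv j) (stdv i)) eij.
by apply/matrixP => a b; rewrite !mxE; ring.
Qed.

Section Plane.
Variable p : nat.
Hypothesis p3 : (p < 3)%N.
Local Notation a := p.*2.
Local Notation b := p.*2.+1.

Let a6 : (a < 6)%N. Proof. lia. Qed.
Let b6 : (b < 6)%N. Proof. lia. Qed.

Lemma sform_stdv_even x : sform x (stdv a) = - entry x b.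
Proof. by rewrite sform_stdv // /dual_sign /dual_idx odd_double mulN1r. Qed.
Lemma sform_stdv_odd x : sform x (stdv b) = entry x a.
Proof. by rewrite sform_stdv // /dual_sign /dual_idx /= odd_double mul1r. Qed.

(** The properties of the first column of plane p; the last one is primitivity. *)
Definition colA x := [/\ forall i, (i < a)%N -> entry x i = 0, bits x = unitv a
  & exists y, sform x y = 1].

Lemma colA_sqprod h x : sqprod p h -> colA x -> colA (h *m x).
Proof.
move=> mh [x0 xb [y xy]]; split; last first.
- by exists (h *m y); rewrite symp_sform //; exact: sqprod_symp mh.
- by rewrite (sqprod_bits _ mh).
move=> i hi; have i6 : (i < 6)%N by lia.
have pi : (dual_idx i < a)%N by rewrite /dual_idx; case: ifP; lia.
have E z : entry z i = dual_sign (dual_idx i) * sform z (stdv (dual_idx i)).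
  rewrite sform_stdv; last by lia.
  have -> := dual_idxK i.
  by rewrite mulrA /dual_sign; case: ifP => _; rewrite ?mulN1r ?opprK ?mul1r ?mulrNN ?mul1r.
rewrite E -(sqprod_fix mh pi (ltnW p3)) symp_sform ?(sqprod_symp mh) //.
by rewrite sform_stdv ?x0 ?mulr0 //; [rewrite /dual_idx; repeat case: ifP; lia|lia].
Qed.

Lemma par_colA x i : colA x -> (i < 6)%N -> par (entry x i) = (i == a).
Proof. by case=> _ xb _ hi; rewrite -nth_bits // xb nth_unitv. Qed.

Lemma colA_neq0 x : colA x -> entry x a != 0.
Proof. by move=> hx; have := par_colA hx a6; rewrite eqxx; case: eqP => // ->. Qed.

Lemma reduce_others m x : (m <= 6)%N -> colA x ->
  exists h, [/\ sqprod p h, entry (h *m x) a = entry x a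
  & forall i, (b < i < m)%N -> `|entry (h *m x) i| < `|entry x a|].
Proof.
elim: m => [|m IH] hm hx; first by exists 1%:M; split;
  [exact: sqprod1|rewrite mul1mx|by move=> i; lia].
have [h [mh ha hi]] := IH (ltnW hm) hx.
case: (leqP m b) => mb.
  by exists h; split=> // i hib; apply: hi; lia.
have hy := colA_sqprod mh hx; set y := h *m x in ha hi hy *.
have [|k hk] := @euclid_step (entry y a) (entry y m) _ (colA_neq0 hy).
  by rewrite !par_colA // eqxx; case: eqP => //; lia.
exists (eichler b m k *m h).
have E j : (j < 6)%N -> entry (eichler b m k *m h *m x) j =
  entry y j + 2 * k * (entry y a * (j == m : nat)
    + sform y (stdv m) * (j == b : nat)).
  move=> hj; rewrite -mulmxA -/y eichlerE //; [|by lia|rewrite /dual_idx; case: ifP; lia].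
  by rewrite entryD entryZ entryD !entryZ sform_stdv_odd !entry_stdv.
split.
- by apply: sqprod_mul => //; apply: sqprod_eichler; lia.
- rewrite E // ha; have -> : (a == m) = false by lia.
  have -> : (a == b) = false by lia.
  by rewrite !Posz_false !mulr0 ?addr0 ?mulr0 ?addr0.
move=> i hib; rewrite E; last by lia.
have -> : (i == b) = false by lia.
rewrite Posz_false mulr0 addr0 -ha; case: eqP => [->|im]; first by rewrite Posz_true mulr1.
by rewrite Posz_false !mulr0 addr0 ha; apply: hi; lia.
Qed.

(** The odd entry x_a is the modulus, and the even entries can be brought below
it one by one. *)
Lemma reduce_col x : colA x -> exists h, [/\ sqprod p h, entry (h *m x) a = entry x a
  & forall i, (a < i < 6)%N -> `|entry (h *m x) i| < `|entry x a|].
Proof.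
move=> hx; have [h [mh ha hi]] := reduce_others (leqnn 6) hx.
have hy := colA_sqprod mh hx; set y := h *m x in ha hi hy *.
have [|k hk] := @euclid_step (entry y a) (entry y b) _ (colA_neq0 hy).
  by rewrite !par_colA // eqxx; case: eqP => //; lia.
exists (transv (stdv b) (2 * k) *m h).
have E j : (j < 6)%N -> entry (transv (stdv b) (2 * k) *m h *m x) j
    = entry y j + 2 * k * entry y a * (j == b : nat).
  by move=> hj; rewrite -mulmxA -/y transvE entryD entryZ sform_stdv_odd entry_stdv.
split.
- by apply: sqprod_mul => //; apply: sqprod_stdv; lia.
- rewrite E // ha; have -> : (a == b) = false by lia.
  by rewrite Posz_false mulr0 addr0.
move=> i hib; rewrite E; last by lia.
case: eqP => [->|nb]; first by rewrite Posz_true mulr1 -ha.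
by rewrite Posz_false mulr0 addr0; apply: hi; lia.
Qed.

(** Minus the identity of a hyperbolic plane, as a product of squares. *)
Lemma flip_col x : x = (- 1) *: stdv a ->
  transv (stdv a) 2 *m (transv (stdv a + stdv b) 2 *m (transv (stdv b) 2 *m x)) = stdv a.
Proof.
move=> ->; have eab : sform (stdv a) (stdv b) = 1 by rewrite sform_stdv_odd entry_stdv // eqxx.
rewrite !transvE !(sformDl, sformZl, sformDr, sformZr) !sform_xx (sformC (stdv b)) eab.
by apply/matrixP => i j; rewrite !mxE; ring.
Qed.

(** Descent on |x_a|: once the other entries are smaller than x_a, any nonzero
one of them reduces x_a further. *)
Lemma euclid_col x : colA x -> exists2 h, sqprod p h & h *m x = stdv a.
Proof.
have [m] := ubnP `|entry x a|%N; elim: m x => [|m IH] x hm hx; first by [].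
have [h [mh ha hi]] := reduce_col hx.
have hy := colA_sqprod mh hx; have [y0 yb [z yz]] := hy.
have step g : sqprod p g -> `|entry (g *m (h *m x)) a| < `|entry x a| ->
    exists2 h, sqprod p h & h *m x = stdv a.
  move=> mg lt; have [||h' mh' E] := IH (g *m (h *m x)).
  - by lia.
  - by apply: colA_sqprod.
  exists (h' *m g *m h); last by rewrite -!mulmxA.
  by apply: sqprod_mul => //; exact: sqprod_mul.
set y := h *m x in ha hi hy y0 yb yz step *.
have ya := par_colA hy a6; rewrite eqxx in ya.
have pary i : (a < i < 6)%N -> par (entry y i) = false.
  by move=> hib; rewrite par_colA //; lia.
(* A nonzero y_b reduces y_a by a transvection.  When y_b = 0, an entry of a later
   plane reduces y_a by an Eichler move, which then changes no other entry. *)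
case: (eqVneq (entry y b) 0) => [yb0|yb0]; last first.
  have [|k hk] := @euclid_step (entry y b) (entry y a) _ yb0; first by rewrite ya pary //; lia.
  apply: (step (transv (stdv a) (2 * (- k)))); first by apply: sqprod_stdv; lia.
  rewrite transvE entryD entryZ sform_stdv_even entry_stdv // eqxx Posz_true mulr1.
  have -> : 2 * - k * - entry y b = 2 * k * entry y b by ring.
  by apply: lt_trans hk _; apply: hi; lia.
case: (boolP (all (fun i => entry y i == 0) (iota a.+2 (6 - a.+2)))) => [/allP yi0|]; last first.
  rewrite -has_predC => /hasP[i]; rewrite mem_iota => hib /= yi0.
  have [|k hk] := @euclid_step (entry y i) (entry y a) _ yi0; first by rewrite ya pary //; lia.
  have pib : (a.+2 <= dual_idx i < 6)%N by rewrite /dual_idx; case: (boolP (odd i)) => o; lia.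
  have pti := dual_idxK i.
  apply: (step (eichler a (dual_idx i) (dual_sign (dual_idx i) * k)));
    first by apply: sqprod_eichler; lia.
  rewrite eichlerE //; [|lia|lia|by rewrite pti; lia].
  rewrite entryD entryZ entryD !entryZ sform_stdv_even yb0 oppr0 mul0r add0r entry_stdv // eqxx Posz_true mulr1.
  rewrite sform_stdv ?pti; last by lia.
  have -> : 2 * (dual_sign (dual_idx i) * k) * (dual_sign (dual_idx i) * entry y i) =
    2 * k * entry y i.
    by rewrite /dual_sign; case: ifP => _; ring.
  by apply: lt_trans hk _; apply: hi; lia.
have yE : y = entry y a *: stdv a.
  apply: entryP => i hib; rewrite entryZ entry_stdv //; case: eqP => [->|ia];
    first by rewrite Posz_true mulr1.
  rewrite Posz_false mulr0; case: (ltnP i a) => [/y0//|ai].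
  by case: (eqVneq i b) => [->//|ib]; apply/eqP/yi0; rewrite mem_iota; lia.
(* Only y_a is left, so primitivity makes it 1 or -1. *)
have : entry y a * sform (stdv a) z = 1 by rewrite -sformZl -yE.
move/(congr1 absz); rewrite abszM => /eqP; rewrite muln_eq1 => /andP[/eqP ya1' _].
have [ya1|ya1] : entry y a = 1 \/ entry y a = -1 by move: ya1'; move: (entry y a) => u; lia.
  by exists h => //; rewrite -/y yE ya1 scale1r.
exists (transv (stdv a) 2 *m (transv (stdv a + stdv b) 2 *m (transv (stdv b) 2 *m h))).
  apply: sqprod_mul; first by apply: (@sqprod_stdv p a 1); lia.
  apply: sqprod_mul; first by apply: (@sqprod_sum p a b 1); lia.
  by apply: sqprod_mul => //; apply: (@sqprod_stdv p b 1); lia.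
by rewrite -!mulmxA -/y; apply: flip_col; rewrite yE ya1.
Qed.

Definition colB x := [/\ forall i, (i < a)%N -> entry x i = 0, bits x = unitv b
  & entry x b = 1].

Lemma clear_others m x : (m <= 6)%N -> colB x -> exists h, [/\ sqprod p h,
    h *m stdv a = stdv a, colB (h *m x)
  & forall i, (b < i < m)%N -> entry (h *m x) i = 0].
Proof.
elim: m => [|m IH] hm hx; first by exists 1%:M; split; rewrite ?mul1mx //;
  [exact: sqprod1|by move=> i; lia].
have [h [mh ha hy hi]] := IH (ltnW hm) hx.
case: (leqP m b) => mb.
  by exists h; split=> // i hib; apply: hi; lia.
set y := h *m x in hi hy *; have [y0 yb y1] := hy.
have pm : par (entry y m) = false by rewrite -nth_bits // yb nth_unitv //; lia.
have [k yk] : exists k, entry y m = 2 * k by exists (entry y m %/ 2)%Z; move: pm; rewrite /par; lia.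
have me : sqprod p (eichler a m k) by apply: sqprod_eichler; lia.
have E z j : (j < 6)%N -> entry (eichler a m k *m z) j =
  entry z j + 2 * k * (- entry z b * (j == m : nat)
    + sform z (stdv m) * (j == a : nat)).
  move=> hj; rewrite eichlerE //; [|by lia|rewrite /dual_idx; case: ifP; lia].
  by rewrite entryD entryZ entryD !entryZ sform_stdv_even !entry_stdv.
have bm : (b == m) = false by lia.
have ba : (b == a) = false by lia.
exists (eichler a m k *m h); rewrite -!(mulmxA (eichler a m k)) ha -/y; split.
- exact: sqprod_mul.
- apply: entryP => j hj; rewrite E // sform_stdv // !entry_stdv ?ba //.
    have -> : (dual_idx m == a) = false by rewrite /dual_idx; case: ifP; lia.
    by rewrite !Posz_false oppr0 !(mul0r, mulr0, addr0).
  by rewrite /dual_idx; case: ifP; lia.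
- split; last by rewrite E // bm ba !Posz_false !(mulr0, addr0).
    move=> i ia; rewrite E; last by lia.
    have -> : (i == m) = false by lia.
    have -> : (i == a) = false by lia.
    by rewrite !Posz_false !(mulr0, addr0) y0.
  by rewrite (sqprod_bits _ me).
move=> i hib; rewrite E; last by lia.
have -> : (i == a) = false by lia.
rewrite Posz_false mulr0 addr0; case: eqP => [->|im].
  by rewrite Posz_true y1 yk; ring.
by rewrite Posz_false !mulr0 addr0; apply: hi; lia.
Qed.

(** The even entries are multiples of 2 x_b = 2, so one move removes each of
them. *)
Lemma clear_col x : colB x -> exists h, [/\ sqprod p h, h *m stdv a = stdv a & h *m x = stdv b].
Proof.
move=> hx; have [h [mh ha hy hi]] := clear_others (leqnn 6) hx.
set y := h *m x in hi hy *; have [y0 yb y1] := hy.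
have pm : par (entry y a) = false by rewrite -nth_bits // yb nth_unitv //; lia.
have [k yk] : exists k, entry y a = 2 * k by exists (entry y a %/ 2)%Z; move: pm; rewrite /par; lia.
exists (transv (stdv a) (2 * k) *m h); rewrite -!mulmxA ha -/y; split.
- by apply: sqprod_mul => //; apply: sqprod_stdv; lia.
- by rewrite transvE sform_xx mulr0 scale0r addr0.
apply: entryP => i hib; rewrite transvE entryD entryZ sform_stdv_even y1 !entry_stdv //.
case: (ltngtP i a) => [ia|ia|->].
- rewrite y0 // Posz_false mulr0 addr0; have -> : (i == b) = false by lia.
  by [].
- rewrite Posz_false mulr0 addr0; case: (eqVneq i b) => [->//|ib].
  by apply: hi; lia.
have -> : (a == b) = false by lia.
by rewrite Posz_true Posz_false yk; ring.
Qed.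

End Plane.

(** Two columns at a time: euclid_col restores the first basis vector of a
hyperbolic plane, and clear_col the second one without moving the first. *)
Theorem level2_generated g : symp g -> level2 g -> sqprod 0 g.
Proof.
suff S m : (m <= 3)%N -> forall g, symp g -> level2 g ->
    (forall j, (j < (3 - m).*2)%N -> g *m stdv j = stdv j) -> sqprod 0 g.
  by move=> gs lg; apply: (S 3%N).
elim: m => [|m IH] m3 {}g gs lg fg.
  by have -> : g = 1%:M; [apply: mx_stdvP => j hj; rewrite mul1mx fg|exact: sqprod1].
move pE : (3 - m.+1)%N => p in fg *.
have p3 : (p < 3)%N by lia.
have cA : colA p (g *m stdv p.*2).
  split; last by exists (g *m stdv p.*2.+1);
    rewrite symp_sform // sform_stdv_odd // entry_stdv ?eqxx //; lia.
    move=> i hi; have pi : (dual_idx i < p.*2)%N by rewrite /dual_idx; case: ifP; lia.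
    have := symp_sform (stdv p.*2) (stdv (dual_idx i)) gs; rewrite (fg _ pi) !sform_stdv; try lia.
    have -> := dual_idxK i.
    rewrite entry_stdv; last by lia.
    have -> : (i == p.*2) = false by lia.
    rewrite Posz_false; by rewrite /dual_sign; case: ifP => _; lia.
  by apply: lg; lia.
have [h mh hE] := euclid_col p3 cA.
set g1 := h *m g.
have fix1 j : (j < p.*2)%N -> g1 *m stdv j = stdv j.
  by move=> hj; rewrite -mulmxA fg // (sqprod_fix mh hj) // ltnW.
have ga : g1 *m stdv p.*2 = stdv p.*2 by rewrite -mulmxA.
have sg1 : symp g1 by exact: sympM (sqprod_symp mh) gs.
have lg1 : level2 g1 by move=> j hj; rewrite -mulmxA (sqprod_bits _ mh) lg.
have cB : colB p (g1 *m stdv p.*2.+1).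
  split; last first.
  - rewrite -[LHS]opprK -sform_stdv_even // sformC opprK -{1}ga symp_sform // sform_stdv_odd // entry_stdv ?eqxx //; lia.
  - by apply: lg1; lia.
  move=> i hi; have pi : (dual_idx i < p.*2)%N by rewrite /dual_idx; case: ifP; lia.
  have := symp_sform (stdv p.*2.+1) (stdv (dual_idx i)) sg1; rewrite (fix1 _ pi) !sform_stdv;
    try lia.
  have -> := dual_idxK i.
  rewrite entry_stdv; last by lia.
  have -> : (i == p.*2.+1) = false by lia.
  by rewrite /dual_sign; case: ifP => _; lia.
have [h2 [mh2 h2a h2b]] := clear_col p3 cB.
have m2 : sqprod 0 (h2 *m g1).
  apply: IH; [by lia|exact: sympM (sqprod_symp mh2) _| |].
    by move=> j hj; rewrite -mulmxA (sqprod_bits _ mh2) lg1.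
  move=> j hj; rewrite -mulmxA; case: (ltnP j p.*2) => jp.
    by rewrite fix1 // (sqprod_fix mh2 jp) // ltnW.
  have [->|->] : j = p.*2 \/ j = p.*2.+1 by lia.
    by rewrite ga.
  by rewrite h2b.
rewrite -[g](mulKmx (sqprod_unit mh)) -/g1 -[g1](mulKmx (sqprod_unit mh2)).
by apply: sqprod_mul; [|apply: sqprod_mul => //]; apply: sqprod_all; apply: sqprod_inv; eassumption.
Qed.

(** * First homology and its characters *)

Fact hclass_is_zmod_morphism (G : groupType) n : zmod_morphism (@hclass G n).
Proof. by move=> z w; rewrite /hclass !piE. Qed.
HB.instance Definition _ (G : groupType) n :=
  GRing.isZmodMorphism.Build (Defs.cycle G n) (Hgrp n G) (@hclass G n)
    (@hclass_is_zmod_morphism G n).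

Lemma H1class_zmod (G : groupType) (g : G) (k : int) : exists h : G, H1class g *~ k = H1class h.
Proof.
have pos (m : nat) : exists h : G, H1class g *~ m%:Z = H1class h.
  elim: m => [|m [h IH]]; first by exists 1%g; rewrite mulr0z H1class1.
  by exists (g * h)%g; rewrite H1classM -IH -[m.+1]add1n PoszD mulrzDr mulr1z.
case: (intP k) => [|m|m]; [exact: (pos 0%N)|exact: (pos m.+1)|].
by have [h E] := pos m.+1; exists (h^-1)%g; rewrite mulrNz E H1classV.
Qed.

Lemma tuple1E (T : Type) (x : 1.-tuple T) : x = [tuple thead x].
Proof. by rewrite [LHS]tuple_eta; apply: val_inj; case: x => [[|? []]]. Qed.

Lemma chain1_ind (G : groupType) (P : chain G 1 -> Prop) :
  P 0 -> (forall c d, P c -> P d -> P (c + d)) ->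
  (forall (g : G) (k : int), P (<< [tuple g] >> *~ k)) -> forall c, P c.
Proof.
move=> P0 PD PU c; rewrite -(freeg_sumE c); apply: big_ind => // x _.
by rewrite -freegZU -[k in k *: _]intz scaler_int [x]tuple1E.
Qed.

(** All 1-chains are cycles, and a sum of bar symbols is homologous to the bar
symbol of the product. *)
Lemma H1class_surj (G : groupType) (x : Hgrp 1 G) : exists g : G, x = H1class g.
Proof.
rewrite -[x]reprK -/(hclass _); move: (repr x) => {x}; case=> c hc.
suff [g [H E]] : exists g : G, exists H : cycle_pred c, hclass (Cycle H) = H1class g.
  by exists g; rewrite -E; congr hclass; apply: val_inj.
elim/chain1_ind: {hc} c => [|c d [g [Hc Ec]] [h [Hd Ed]]|g k].
- exists 1%g; have H : cycle_pred (0 : chain G 1) by rewrite /= raddf0.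
  exists H; rewrite H1class1 -[RHS](raddf0 (@hclass G 1)); congr hclass; exact: val_inj.
- exists (g * h)%g; have H : cycle_pred (c + d) by exact: (rpredD Hc Hd).
  exists H; rewrite H1classM -Ec -Ed -raddfD; congr hclass; exact: val_inj.
have [h E] := H1class_zmod g k; exists h.
have H : cycle_pred (<< [tuple g] >> *~ k) by exact: (rpredMz _ (bar1_cycle g)).
exists H; rewrite -E -raddfMz; congr hclass; apply: val_inj.
by rewrite [RHS]raddfMz.
Qed.

(** The linear extension of K to 1-chains takes the boundary of [a|b] to
K a + K b - K (a b). *)
Lemma H1class_hom (G : groupType) (K : G -> int) (m : int) :
  (forall g h, (m %| K (g * h)%g - K g - K h)%Z) ->
  forall g h, H1class g = H1class h -> (m %| K g - K h)%Z.
Proof.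
move=> KM g h /hclassP[c /= E].
pose phi : chain G 1 -> int^o := fglift (fun x : 1.-tuple G => K (thead x) : int^o).
have phiB : {morph phi : x y / x - y} by exact: lift_is_additive.
have phiU x : phi << x >> = K (thead x) by rewrite /phi liftU scale1r.
have -> : K g - K h = phi (bnd c) by rewrite -E phiB !phiU.
pose phiA : {additive chain G 1 -> int^o} :=
  HB.pack phi (GRing.isZmodMorphism.Build _ _ phi phiB).
rewrite -[phi]/(phiA : _ -> _) -(freeg_sumE c) !raddf_sum.
apply: rpred_sum => x _; rewrite -freegZU !raddf_intZ.
rewrite dvdz_mull // [X in phiA X]/= bndU !big_ord_recl big_ord0 addr0.
rewrite !raddfD !raddf_intZ /= !phiU.
have [a [b ->]] : exists a, exists b, x = [tuple a; b].
  by case: x => [[|a [|b [|? ?]]]] // i; exists a, b; apply: val_inj.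
rewrite /thead !face_tnth /= !(tnth_nth a) /= /bump /= expr0 expr1 expr2 mulrNN mulr1.
rewrite !scale1r scaleN1r.
have -> : K b + (- K (a * b)%g + K a) = - (K (a * b)%g - K a - K b) by ring.
by rewrite rpredN; exact: KM.
Qed.

(** K induces an isomorphism from H_1 to Z/4. *)
Definition H1char n (q : quadref n) (K : Stab q -> 'Z_4) :=
  [/\ forall g h : Stab q, K (g * h)%g = K g + K h,
      forall g h : Stab q, H1class g = H1class h <-> K g = K h
    & exists g : Stab q, K g = 1].

Section H1char.
Variables (n : nat) (q : quadref n) (K : Stab q -> 'Z_4).
Hypothesis HK : H1char K.

Lemma H1char_zmod (g h : Stab q) (k : int) : H1class g *~ k = H1class h -> K h = K g *~ k.
Proof.
have [KM KE _] := HK.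
have K1 : K 1%g = 0 by apply: (addrI (K 1%g)); rewrite -KM mulg1 addr0.
have KV x : K (x^-1)%g = - K x by apply: (addrI (K x)); rewrite -KM mulgV K1 subrr.
have pos (m : nat) h' : H1class g *~ m%:Z = H1class h' -> K h' = K g *~ m%:Z.
  elim: m h' => [|m IH] h'; first by rewrite !mulr0z -(H1class1 (Stab q)) -K1 => /KE.
  have [x E] := H1class_zmod g m; rewrite -[m.+1]addn1 PoszD !mulrzDr !mulr1z E -H1classM.
  by move/KE <-; rewrite KM (IH x E).
case: (intP k) => [|m|m]; [exact: (pos 0%N)|exact: (pos m.+1)|].
move=> E; have := pos m.+1 (h^-1)%g; rewrite KV H1classV -E mulrNz opprK => /(_ erefl) h'.
by rewrite mulrNz -h' opprK.
Qed.

Lemma H1char_cyclic (g : Stab q) : odd4 (K g) -> cyclic_on 4 (H1class g).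
Proof.
move=> og; have [KM KE _] := HK; set u := H1class g.
have uE (a b : int) : u *~ a = u *~ b <-> (K g *~ a = K g *~ b).
  have [x Ex] := H1class_zmod g a; have [y Ey] := H1class_zmod g b.
  by rewrite -(H1char_zmod Ex) -(H1char_zmod Ey) /u Ex Ey; exact: KE.
pose f (z : 'Z_4) : Hgrp 1 (Stab q) := u *~ (val z)%:Z.
have z4E (z : 'Z_4) : z = (val z)%:R by rewrite natr_Zp.
have Kf (z : 'Z_4) : K g *~ (val z)%:Z = K g * z.
  by rewrite -pmulrn -mulr_natr -z4E.
have fB : zmod_morphism f.
  move=> x y; rewrite /f -mulrzBr; apply/uE.
  by rewrite Kf mulrzBr !Kf mulrBr.
pose fA : {additive 'Z_4 -> Hgrp 1 (Stab q)} :=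
  HB.pack f (GRing.isZmodMorphism.Build _ _ f fB).
exists fA; split; last by rewrite /= /f /= mulr1z.
have gg : K g * K g = 1 by exact: odd4_sqr.
have finj : injective f.
  move=> x y /uE; rewrite !Kf => /(congr1 ( *%R (K g))).
  by rewrite !mulrA gg !mul1r.
have fsurj y : exists x, f x == y.
  have [h ->] := H1class_surj y; exists (K g * K h); apply/eqP; rewrite /f.
  have [x Ex] := H1class_zmod g (val (K g * K h))%:Z.
  rewrite /u Ex; apply/KE; rewrite (H1char_zmod Ex) Kf mulrA gg mul1r //.
exists (fun y => xchoose (fsurj y)) => [x|y].
  by apply: finj; apply/eqP; exact: (xchooseP (fsurj (f x))).
by apply/eqP; exact: (xchooseP (fsurj y)).
Qed.

End H1char.

Lemma qiso_inv_symp n (q q' : quadref n) (B : qiso q q') : symp (invmx B).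
Proof. by apply: sympV; exact: qiso_symp. Qed.

Lemma qiso_unit n (q q' : quadref n) (B : qiso q q') : (B : 'M_n) \in unitmx.
Proof. by have /andP[] := qiso_symp B. Qed.

Definition qiso_inv n (q q' : quadref n) (B : qiso q q') : qiso q' q.
Proof.
refine (@QIso n q' q (invmx B) (qiso_inv_symp B) _) => x.
by rewrite -(qisoE B) mulKVmx // qiso_unit.
Defined.

Definition qiso_comp n (q q' q'' : quadref n) (B : qiso q q') (C : qiso q' q'') : qiso q q''.
Proof.
refine (@QIso n q q'' (C *m B) (sympM (qiso_symp C) (qiso_symp B)) _) => x.
by rewrite -mulmxA !qisoE.
Defined.

Section Transport.
Variables (n : nat) (q q' : quadref n) (B : qiso q q') (K : Stab q' -> 'Z_4).
Hypothesis HK : H1char K.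

Lemma stab_conjK (g : Stab q) : stab_conj (qiso_inv B) (stab_conj B g) = g.
Proof.
by apply: val_inj; rewrite /= invmxK !mulmxA mulVmx ?qiso_unit // mul1mx mulmxKV // qiso_unit.
Qed.
Lemma stab_conjVK (g : Stab q') : stab_conj B (stab_conj (qiso_inv B) g) = g.
Proof.
by apply: val_inj; rewrite /= invmxK !mulmxA mulmxV ?qiso_unit // mul1mx mulmxK // qiso_unit.
Qed.

Lemma H1char_conj : H1char (fun g => K (stab_conj B g)).
Proof.
have [KM KE [g1 Kg1]] := HK; split.
- by move=> g h; rewrite gmulfM KM.
- move=> g h; rewrite -KE -!Hmap_H1class; split=> [->//|E].
  rewrite -[g]stab_conjK -[h]stab_conjK -!(Hmap_H1class (stab_conj (qiso_inv B))).
  by rewrite -!(Hmap_H1class (stab_conj B)) E.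
by exists (stab_conj (qiso_inv B) g1); rewrite stab_conjVK.
Qed.
End Transport.

(** Both classes are compared in H_1 of the common target of B1 and B2, where K
separates classes; the isometry B2^-1 B1 then carries one to the other. *)
Lemma same_class_H1char n (q1 q2 q : quadref n) (B1 : qiso q1 q) (B2 : qiso q2 q)
    (K : Stab q -> 'Z_4) (g : Stab q1) (h : Stab q2) (m : int) :
  H1char K -> K (stab_conj B1 g) = K (stab_conj B2 h) *~ m ->
  H1class g =~ H1class h *~ m.
Proof.
move=> HK E; exists (qiso_comp B1 (qiso_inv B2)); rewrite Hmap_H1class.
have HK2 := H1char_conj B2 HK; have [_ KE _] := HK2.
have [x Ex] := H1class_zmod h m; rewrite Ex; apply/KE.
rewrite (H1char_zmod HK2 Ex) -E; congr K; apply: val_inj => /=.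
rewrite invmx_mul ?unitmx_inv ?qiso_unit // invmxK !mulmxA.
by rewrite mulmxV ?qiso_unit // mul1mx mulmxK ?qiso_unit.
Qed.

(** * The isomorphism from first homology to Z/4 *)

Section Degree.
Variables (n : nat) (Kc Kd : 'M[int]_(n, 6)) (q : quadref 6) (delta : bool).
Hypothesis KK : Kc^T *m Kd - Kd^T *m Kc = Omega 6.
Hypothesis Kq : forall x, q x = (((Kc *m x)^T *m (Kd *m x)) 0 0)%:~R.
Hypothesis Hq : forall x, q x = (bquad delta (bits x))%:R.

Section WithT.
Variable t : Hgrp 1 (Stab q).
Hypothesis Ht : graded Kc Kd t (transv (bvec base_vec) 1) 1.
Local Notation gr := (graded Kc Kd t).

Lemma gradable_all g : stab_pred q g -> gradable Kc Kd t g.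
Proof.
move: g; apply: (gradable_level2 KK Kq Hq Ht) => g /andP[sg' _] lg.
elim: (level2_generated sg' lg) => [|w k h wl _ _ IH].
  by exists 0; exact: graded1.
by apply: (gradable_mul KK) => //; exact: (gradable_sqr KK Kq Hq Ht).
Qed.

Lemma graded_nonsing s : s \in nonsing delta -> gr (transv (bvec s) 1) 1.
Proof. by case/(transv_graded_nonsing Kq Hq Ht). Qed.

(** Minus the identity of the plane where q = x2 x3 is a product of three
squares of transvections, of degrees 0, 2 and 0, and its own square is 1. *)
Lemma graded_1_4 : gr 1%:M 4.
Proof.
pose s := addv (unitv 2) (unitv 3).
have sE : bvec s = stdv 2 + stdv 3.
  by apply: entryP => -[|[|[|[|[|[|]]]]]] // _; rewrite entryD /stdv !entry_bvec.
have so : s \in nonsing delta by case: (delta).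
have gs := graded_mul Omega6_sqr KK (graded_nonsing so) (graded_nonsing so).
have g2 : gr (transv (stdv 2) 2) 0 by apply: (graded_sqr KK Kq Hq Ht) => //; case: (delta).
have g3 : gr (transv (stdv 3) 2) 0 by apply: (graded_sqr KK Kq Hq Ht) => //; case: (delta).
have := graded_mul Omega6_sqr KK (graded_mul Omega6_sqr KK g2 gs) g3.
rewrite transvD sE; set M := _ *m _; rewrite add0r addr0 => gM.
have := graded_mul Omega6_sqr KK gM gM; have -> : M *m M = 1%:M; last by [].
have ME x : M *m x = x - 2 *: (entry x 2 *: stdv 2 + entry x 3 *: stdv 3).
  rewrite /M -!mulmxA !transvE !(sformDl, sformZl, sformDr, sformZr) !sform_xx.
  rewrite (sformC (stdv 3) (stdv 2)) !sform_stdv // /dual_sign /dual_idx /= entry_stdv //.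
  by apply/matrixP => i j; rewrite !mxE /=; ring.
have actM x i : (i < 6)%N -> entry (M *m x) i
    = entry x i - 2 * (entry x 2 * (i == 2%N : nat) + entry x 3 * (i == 3%N : nat)).
  move=> hi; rewrite ME entryD -scaleN1r scalerA entryZ entryD !entryZ !entry_stdv //; ring.
apply: mx_actP => x; rewrite -mulmxA mul1mx; apply: entryP => i hi.
rewrite !actM //.
by case: i hi => [|[|[|[|[|[|]]]]]] //= _; lia.
Qed.

Lemma t4 : t *+ 4 = 0.
Proof.
have [H [E _ _]] := graded_1_4; rewrite pmulrn -E -[RHS](H1class1 (Stab q)).
by congr H1class; apply: val_inj.
Qed.

End WithT.

(** K g is the degree of g mod 4.  It exists by generation, it is unique by
phases, and since 4 t = 0 it determines the class of g.  The last clause reads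
it off directly when g preserves the standard Lagrangian. *)
Theorem H1char_exists : exists K : Stab q -> 'Z_4,
  [/\ H1char K,
      forall s (H : stab_pred q (transv (bvec s) 1)), s \in nonsing delta -> K (MkStab H) = 1,
      forall w (H : stab_pred q (transv (bvec w) 2)), w \in level2_vecs -> bquad delta w = false ->
         K (MkStab H) = 0
    & forall g : Stab q, actC Kc Kd g 0 1%:M = 0 -> K g = 1 - \det (actD Kc Kd g 0 1%:M)].
Proof.
have q0 : q (bvec base_vec) = 1 by rewrite Hq bits_bvec //; case: (delta).
have H0 : stab_pred q (transv (bvec base_vec) 1) by apply: (stab_transv Kq); left.
pose t := H1class (MkStab H0).
have Ht : graded Kc Kd t (transv (bvec base_vec) 1) 1.
  exact: (graded_transv1 Omega6_sqr Kq q0 (erefl t)).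
have gradable_ (g : Stab q) : gradable Kc Kd t g by case: g => A HA; exact: gradable_all.
pose k (g : Stab q) := projT1 (cid (gradable_ g)).
have kE g : graded Kc Kd t (g : Stab q) (k g) := projT2 (cid (gradable_ g)).
have kU (g : Stab q) k' : graded Kc Kd t g k' -> (k g)%:~R = k'%:~R :> 'Z_4.
  exact: (graded_uniq Omega6_sqr KK (kE g)).
have kH (g : Stab q) : H1class g = t *~ k g.
  by have [H [<- _ _]] := kE g; congr H1class; exact: val_inj.
have kM (g h : Stab q) : (k (g * h)%g)%:~R = (k g)%:~R + (k h)%:~R :> 'Z_4.
  rewrite -intrD; apply: kU; exact: (graded_mul Omega6_sqr KK (kE g) (kE h)).
have d4 (z : int) : (z%:~R = 0 :> 'Z_4) <-> (4 %| z)%Z.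
  split=> [|/dvdzP[m ->]]; last first.
    by rewrite rmorphM /= (_ : 4%:~R = 0 :> 'Z_4) ?mulr0 //; exact: val_inj.
  have -> : z = (z %/ 4)%Z * 4 + (z %% 4)%Z by exact: divz_eq.
  rewrite rmorphD rmorphM /= (_ : 4%:~R = 0 :> 'Z_4); last exact: val_inj.
  rewrite mulr0 add0r.
  have := ltz_pmod z (isT : 0 < 4 :> int); have := modz_ge0 z (isT : 4 != 0 :> int).
  case: (z %% 4)%Z => // -[|[|[|[|]]]] // _ _ /(congr1 val) //= _.
  by rewrite addr0 dvdz_mull.
exists (fun g => (k g)%:~R); split.
- split=> [//|g h|]; last first.
    by exists (MkStab H0); rewrite (kU (MkStab H0) 1).
  split=> [E|/eqP].
    apply/eqP; rewrite -subr_eq0 -intrB; apply/eqP/d4.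
    apply: (H1class_hom _ E) => g' h'; apply/d4.
    by rewrite !rmorphB /= kM addrAC addrK subrr.
  rewrite -subr_eq0 -intrB => /eqP/d4/dvdzP[m E].
  rewrite !kH -[k g](subrK (k h)) E mulrzDr [m * 4]mulrC mulrzA -pmulrn.
  by rewrite (t4 Ht) mul0rz add0r.
- by move=> s H so; rewrite (kU (MkStab H) 1) //; exact: (graded_nonsing Ht so).
- by move=> w H wl qw; rewrite (kU (MkStab H) 0) //; exact: (graded_sqr KK Kq Hq Ht).
move=> g eC; have [_ [_ a _]] := kE g.
by have := acts_stable a eC.
Qed.
End Degree.

(** * Computations with explicit matrices *)

(** Matrices given by entry functions: identities between explicit matrices
become closed boolean computations. *)
Definition funmx m n (f : nat -> nat -> int) : 'M[int]_(m, n) := \matrix_(i, j) f i j.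

Definition isum (n : nat) (f : nat -> int) : int := foldr (fun k s => f k + s) 0 (iota 0 n).
Lemma isumE n (f : nat -> int) : \sum_(i < n) f i = isum n f.
Proof.
rewrite -(big_mkord xpredT f) /index_iota subn0 /isum.
by elim: (iota 0 n) => [|k s IH]; rewrite ?big_nil ?big_cons //= IH.
Qed.

Definition fmul n (f g : nat -> nat -> int) i j := isum n (fun k => f i k * g k j).

Lemma funmx_eq m n f g :
  all (fun i => all (fun j => f i j == g i j) (iota 0 n)) (iota 0 m) -> funmx m n f = funmx m n g.
Proof.
move=> /allP h; apply/matrixP => i j; rewrite !mxE.
have hi := h i; rewrite mem_iota /= ltn_ord in hi; have /allP/(_ j) := hi isT.
by rewrite mem_iota /= ltn_ord => /(_ isT)/eqP.
Qed.

Lemma funmxM m n p f g : funmx m n f *m funmx n p g = funmx m p (fmul n f g).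
Proof. by apply/matrixP => i j; rewrite !mxE /fmul -isumE; apply: eq_bigr => k _; rewrite !mxE. Qed.
Lemma funmxT m n f : (funmx m n f)^T = funmx n m (fun i j => f j i).
Proof. by apply/matrixP => i j; rewrite !mxE. Qed.
Lemma funmxB m n f g : funmx m n f - funmx m n g = funmx m n (fun i j => f i j - g i j).
Proof. by apply/matrixP => i j; rewrite !mxE. Qed.
Lemma funmxZ m n k f : k *: funmx m n f = funmx m n (fun i j => k * f i j).
Proof. by apply/matrixP => i j; rewrite !mxE. Qed.
Definition fid i j : int := (i == j :> nat : nat).
Lemma funmx1 n : 1%:M = funmx n n fid.
Proof. by apply/matrixP => i j; rewrite !mxE natz. Qed.
Definition fOm (i j : nat) : int :=
  if ~~ odd i && (j == i.+1 :> nat) then 1 else if ~~ odd j && (i == j.+1 :> nat) then -1 else 0.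
Lemma funmxOmega n : Omega n = funmx n n fOm.
Proof. by []. Qed.
Definition fblock m (f g : nat -> nat -> int) i j : int :=
  if (i < m)%N then (if (j < m)%N then f i j else 0)
  else if (j < m)%N then 0 else g (i - m)%N (j - m)%N.
Lemma funmx_block m n f g : block_mx (funmx m m f) 0 0 (funmx n n g) =
  funmx (m + n) (m + n) (fblock m f g).
Proof.
have lt (x : 'I_m) : (x < m)%N = true by rewrite ltn_ord.
have ge (x : nat) : (m + x < m)%N = false by rewrite ltnNge leq_addr.
apply/matrixP => i j; case: (split_ordP i) => {}i ->; case: (split_ordP j) => {}j ->;
  rewrite ?block_mxEul ?block_mxEur ?block_mxEdl ?block_mxEdr !mxE /fblock /= ?lt ?ge //.
by rewrite !addKn.
Qed.
Definition fswap m i j : int := ((i + m == j :> nat) || (j + m == i :> nat) : nat).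
Lemma funmx_swap m : block_mx 0 1%:M 1%:M 0 = funmx (m + m) (m + m) (fswap m).
Proof.
apply/matrixP => i j; case: (split_ordP i) => {}i ->; case: (split_ordP j) => {}j ->;
  rewrite ?block_mxEul ?block_mxEur ?block_mxEdl ?block_mxEdr !mxE /fswap /= ?natz -?val_eqE /=;
  have := ltn_ord i; have := ltn_ord j; set x := nat_of_ord i; set y := nat_of_ord j; lia.
Qed.
Definition f2 (a b c d : int) (i j : nat) : int :=
  if i == 0%N then (if j == 0%N then a else b) else (if j == 0%N then c else d).
Lemma funmx_mx2 a b c d : mx2 a b c d = funmx 2 2 (f2 a b c d).
Proof. by []. Qed.
Definition fvec (s : seq bool) (i j : nat) : int := (nth false s i : nat).
Lemma funmx_bvec s : bvec s = funmx 6 1 (fvec s).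
Proof. by []. Qed.
Definition ftransv s k i j : int :=
  fid i j - k * fmul 6 (fmul 1 (fvec s) (fun i j => fvec s j i)) fOm i j.
Lemma funmx_transv s k : transv (bvec s) k = funmx 6 6 (ftransv s k).
Proof. by rewrite /transv funmx_bvec funmxT funmxOmega !funmxM funmxZ funmx1 funmxB. Qed.

Definition lfun (l : seq (seq int)) i j : int := nth 0 (nth [::] l i) j.

Definition bsum n (f : nat -> bool) : bool := foldr (fun k s => f k (+) s) false (iota 0 n).
Lemma par_isum n f : par (isum n f) = bsum n (fun i => par (f i)).
Proof. by rewrite /isum /bsum; elim: (iota 0 n) => //= k s IH; rewrite parD IH. Qed.
Lemma eq_bsum n (f g : nat -> bool) : (forall i, (i < n)%N -> f i = g i) -> bsum n f = bsum n g.
Proof.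
move=> h; have : {in iota 0 n, f =1 g} by move=> i; rewrite mem_iota => /andP[_ /h].
rewrite /bsum; elim: (iota 0 n) => //= k s IH fg; rewrite fg ?mem_head // IH //.
by move=> i hi; apply: fg; rewrite inE hi orbT.
Qed.
Definition bapp (f : nat -> nat -> int) (s : seq bool) i :=
  bsum 6 (fun j => par (f i j) && nth false s j).
Lemma par_funmx m f (x : 'cV_6) (i : 'I_m) : par ((funmx m 6 f *m x) i ord0) = bapp f (bits x) i.
Proof.
rewrite mxE (eq_bigr (fun k : 'I_6 => f i k * entry x k)); last first.
  by move=> k _; rewrite mxE entryE.
rewrite (@isumE 6 (fun k => f i k * entry x k)) par_isum; apply: eq_bsum => k hk;
  by rewrite parM nth_bits.
Qed.

(** Laplace expansion along the first row. *)
Fixpoint fdet n (f : nat -> nat -> int) : int :=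
  if n is n'.+1 then isum n (fun j => f 0%N j * ((-1) ^+ j * fdet n' (fun i k => f i.+1 (bump j k))))
  else 1.
Lemma fdetE n f : \det (funmx n n f) = fdet n f.
Proof.
elim: n f => [|n IH] f; first by rewrite det_mx00.
rewrite (expand_det_row _ 0) /= -isumE; apply: eq_bigr => j _.
rewrite mxE /cofactor add0n -IH; congr (_ * (_ * \det _)).
by apply/matrixP => i k; rewrite !mxE.
Qed.

Definition bquad3 (a b c : bool) (s : seq bool) : bool :=
  let p (d : bool) i := (nth false s i && nth false s i.+1)
     (+) (d && (nth false s i (+) nth false s i.+1)) in
  p a 0%N (+) p b 2%N (+) p c 4%N.

Lemma bquad_bquad3 delta s : bquad delta s = bquad3 delta false true s.
Proof.
rewrite /bquad /bquad3 /=; case: delta; do 6! case: (nth false s _) => //=.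
Qed.

Lemma qstd_par (d : 'Z_2) (y : 'cV[int]_2) : qstd_val d y
  = ((par (y 0 0) && par (y 1 0)) (+) (odd d && (par (y 0 0) (+) par (y 1 0))))%:R.
Proof.
rewrite /qstd_val !par_Z2; case: (par _); case: (par _);
 by case: d => [[|[|]]] // ?; apply: val_inj.
Qed.

Lemma natr_addb (a b : bool) : a%:R + b%:R = (a (+) b)%:R :> 'Z_2.
Proof. by case: a; case: b; apply: val_inj. Qed.

Lemma qsum_lE (a b c : 'Z_2) (x : 'cV[int]_6) :
  (qsum (qsum (qstd a) (qstd b)) (qstd c) : quadref 6) x =
    (bquad3 (odd a) (odd b) (odd c) (bits x))%:R.
Proof.
rewrite /= /qsum_val /= /qsum_val /= !qstd_par !natr_addb !mxE /bquad3 !nth_bits // /entry.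
by do ![congr (_ (+) _) | congr (_ && _) | congr (par (x _ _)) | congr (nat_of_bool _)%:R];
  apply: val_inj; rewrite /= inordK.
Qed.

Lemma qsum_rE (a b c : 'Z_2) (x : 'cV[int]_6) :
  (qsum (qstd a) (qsum (qstd b) (qstd c)) : quadref 6) x =
    (bquad3 (odd a) (odd b) (odd c) (bits x))%:R.
Proof.
rewrite /= /qsum_val /= /qsum_val /= !qstd_par !natr_addb addbA !mxE /bquad3 !nth_bits // /entry.
by do ![congr (_ (+) _) | congr (_ && _) | congr (par (x _ _)) | congr (nat_of_bool _)%:R];
  apply: val_inj; rewrite /= inordK.
Qed.

Definition fT (f : nat -> nat -> int) i j := f j i.

Section Iso.
Variables (q q' : quadref 6) (a b c a' b' c' : bool) (f : nat -> nat -> int).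
Hypothesis hq : forall x, q x = (bquad3 a b c (bits x))%:R.
Hypothesis hq' : forall x, q' x = (bquad3 a' b' c' (bits x))%:R.
(** Both quadratic forms only depend on bits, so that the isometry condition can
be tested on bit lists. *)
Definition iso_check :=
  all (fun s => bquad3 a' b' c' (mkseq (bapp f s) 6) == bquad3 a b c s) bitvecs
  && all (fun i => all (fun j => fmul 6 (fmul 6 (fT f) fOm) f i j == fOm i j) (iota 0 6)) (iota 0 6).
Hypothesis ck : iso_check.

Lemma funmx_inv_symp : - (Omega 6 *m (funmx 6 6 f)^T *m Omega 6) *m funmx 6 6 f = 1%:M.
Proof.
have [_ /funmx_eq E] := andP ck; rewrite -!funmxM -funmxT -funmxOmega in E.
by rewrite mulNmx -!mulmxA (mulmxA _^T) E Omega6_sqr opprK.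
Qed.

Lemma funmx_symp : symp (funmx 6 6 f).
Proof.
have [_ /funmx_eq E] := andP ck; rewrite -!funmxM -funmxT -funmxOmega in E.
by apply/andP; split; [have [] := mulmx1_unit funmx_inv_symp|apply/eqP].
Qed.

Lemma bits_funmx x : bits (funmx 6 6 f *m x) = mkseq (bapp f (bits x)) 6.
Proof.
apply: (@eq_from_nth _ false); rewrite !size_mkseq // => i hi.
by rewrite nth_bits // nth_mkseq // /entry par_funmx inordK.
Qed.

Lemma funmx_qE x : q' (funmx 6 6 f *m x) = q x.
Proof.
have [/allP/(_ (bits x)) E _] := andP ck; rewrite hq hq' bits_funmx.
by rewrite (eqP (E _)) // mem_bitvecs size_mkseq.
Qed.

Definition iso : qiso q q' := QIso funmx_symp funmx_qE.

(** Conjugation by f, with the inverse of a symplectic matrix written as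
- Omega f^T Omega. *)
Definition fconj (g : nat -> nat -> int) :=
  fmul 6 (fmul 6 f g) (fun i j => - fmul 6 (fmul 6 fOm (fT f)) fOm i j).

Lemma funmx_conj (g : nat -> nat -> int) :
  funmx 6 6 f *m funmx 6 6 g *m invmx (funmx 6 6 f) = funmx 6 6 (fconj g).
Proof.
have -> : invmx (funmx 6 6 f) = - (Omega 6 *m (funmx 6 6 f)^T *m Omega 6).
  have [_ u] := mulmx1_unit funmx_inv_symp.
  by rewrite -[LHS]mul1mx -funmx_inv_symp mulmxK.
rewrite /fconj -!funmxM; congr (_ *m _).
by rewrite funmxT funmxOmega !funmxM; apply/matrixP => i j; rewrite !mxE.
Qed.
End Iso.

Section Charts.
Variables (n : nat) (c d : nat -> nat -> int) (delta : bool) (q : quadref 6).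
Hypothesis hq : forall x, q x = (bquad delta (bits x))%:R.
(** The rows of c and d are the coordinates of an isometric embedding in the
hyperbolic space of genus n. *)
Definition chart_check :=
  all (fun s => bsum n (fun i => bapp c s i && bapp d s i) == bquad delta s) bitvecs
  && all (fun i => all (fun j => fmul n (fT c) d i j - fmul n (fT d) c i j == fOm i j) (iota 0 6)) (iota 0 6).
Hypothesis ck : chart_check.

Lemma chart_KK : (funmx n 6 c)^T *m funmx n 6 d - (funmx n 6 d)^T *m funmx n 6 c = Omega 6.
Proof.
by have [_ /funmx_eq E] := andP ck; rewrite !funmxT !funmxM funmxB funmxOmega.
Qed.

Lemma chart_Kq x : q x = (((funmx n 6 c *m x)^T *m (funmx n 6 d *m x)) 0 0)%:~R.
Proof.
rewrite par_Z2 hq; congr (nat_of_bool _)%:R.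
have [/allP/(_ (bits x)) E _] := andP ck; rewrite -(eqP (E _)); last first.
  by rewrite mem_bitvecs size_mkseq.
rewrite mxE; under eq_bigr do rewrite mxE.
have P : {morph par : x y / x + y >-> x (+) y} by exact: parD.
rewrite (big_morph par P (erefl : par 0 = false)).
rewrite (eq_bigr (fun i : 'I_n => bapp c (bits x) i && bapp d (bits x) i)); last first.
  by move=> i _; rewrite parM !par_funmx.
rewrite -(big_mkord xpredT (fun i => bapp c (bits x) i && bapp d (bits x) i)).
rewrite /index_iota subn0 /bsum.
by elim: (iota 0 n) => [|k s IH]; rewrite ?big_nil ?big_cons //= IH.
Qed.

Definition fminus1 (g : nat -> nat -> int) i j := g i j - fid i j.
Definition fstabC (g : nat -> nat -> int) := fmul 6 (fmul 6 d (fminus1 g)) (fmul 6 fOm (fT d)).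
Definition fstabD (g : nat -> nat -> int) i j :=
  fid i j - fmul 6 (fmul 6 d (fminus1 g)) (fmul 6 fOm (fT c)) i j.

(** Invariance of the standard Lagrangian, with determinant -1 on it. *)
Definition swap_check g :=
  all (fun i => all (fun j => fstabC g i j == 0) (iota 0 n)) (iota 0 n)
  && (fdet n (fstabD g) == -1).

Lemma chart_swap (g : nat -> nat -> int) (A : 'M[int]_6) : A = funmx 6 6 g -> swap_check g ->
  actC (funmx n 6 c) (funmx n 6 d) A 0 1%:M = 0
  /\ 1 - \det (actD (funmx n 6 c) (funmx n 6 d) A 0 1%:M) = 2.
Proof.
move=> -> /andP[sC /eqP sD].
have Am : funmx 6 6 g - 1%:M = funmx 6 6 (fminus1 g) by rewrite funmx1 funmxB.
rewrite /actC /actD /pull mul0mx !add0r mul1mx -!map_mxM Am funmxOmega !funmxT !funmxM -/(fstabC g).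
split.
  have -> : funmx n n (fstabC g) = funmx n n (fun _ _ => 0) by exact: funmx_eq.
  by apply/matrixP => i j; rewrite !mxE.
have -> : 1%:M - map_mx intr (funmx n n (fmul 6 (fmul 6 d (fminus1 g)) (fmul 6 fOm (fT c))))
   = map_mx (intr : int -> 'Z_4) (funmx n n (fstabD g)).
  apply/matrixP => i j; rewrite !mxE /fstabD rmorphB /fid /=.
  by rewrite -[(i == j)%:R]/((nat_of_ord i == j)%:R); case: (_ == _).
by rewrite det_map_mx fdetE sD; exact: val_inj.
Qed.

Definition frot_plane1 : nat -> nat -> int := lfun
  [:: [:: 1; 0; 0; 0; 0; 0]; [:: 0; 1; 0; 0; 0; 0]; [:: 0; 0; 0; -1; 0; 0];
      [:: 0; 0; 1; 0; 0; 0]; [:: 0; 0; 0; 0; 1; 0]; [:: 0; 0; 0; 0; 0; 1]].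
Definition fshear_plane2 : nat -> nat -> int := lfun
  [:: [:: 1; 0; 0; 0; 0; 0]; [:: 0; 1; 0; 0; 0; 0]; [:: 0; 0; 1; 0; 0; 0];
      [:: 0; 0; 0; 1; 0; 0]; [:: 0; 0; 0; 0; 1; 1]; [:: 0; 0; 0; 0; 0; 1]].

(** The rotation of plane 1 is T_(e+f) T_f^2, and the shear of plane 2 is
T_e^-1. *)
Theorem chart : exists K : Stab q -> 'Z_4, [/\ H1char K,
    forall g : Stab q, (g : 'M_6) = funmx 6 6 frot_plane1 -> K g = 1,
    forall g : Stab q, (g : 'M_6) = funmx 6 6 fshear_plane2 -> K g = -1
  & forall (g : Stab q) f, (g : 'M_6) = funmx 6 6 f -> swap_check f -> K g = 2].
Proof.
have [K [HK K1 K0 Kst]] := H1char_exists chart_KK chart_Kq hq.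
have Kq := chart_Kq; have [KM KE _] := HK.
have Ke1 : K 1%g = 0 by apply: (addrI (K 1%g)); rewrite -KM mulg1 addr0.
exists K; split=> // [g gE|g gE|g f gE ckf].
- pose s := addv (unitv 2) (unitv 3).
  have qs : q (bvec s) = 1 by rewrite hq bits_bvec //; case: (delta).
  have H1 : stab_pred q (transv (bvec s) 1) by apply: (stab_transv Kq); left.
  have H2 : stab_pred q (transv (bvec (unitv 3)) 2) by apply: (stab_transv Kq); right.
  have -> : g = (MkStab H1 * MkStab H2)%g.
    apply: val_inj; rewrite /= gE !funmx_transv funmxM; apply: funmx_eq; by vm_compute.
  by rewrite KM K1 ?K0 ?addr0 //; case: (delta).
- have qs : q (bvec base_vec) = 1 by rewrite hq bits_bvec //; case: (delta).
  have H1 : stab_pred q (transv (bvec base_vec) 1) by apply: (stab_transv Kq); left.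
  have : (g * MkStab H1)%g = 1%g.
    apply: val_inj; rewrite /= gE funmx_transv funmxM funmx1; apply: funmx_eq; by vm_compute.
  move/(congr1 K); rewrite KM Ke1 K1; last by case: (delta).
  by move/eqP; rewrite addr_eq0 => /eqP.
by have [C0 <-] := chart_swap gE ckf; apply: Kst.
Qed.
End Charts.

(** * The classes and their values *)

Lemma Hmap_point (G G' : groupType) (f : {multiplicative G -> G'}) : Hmap f (point G) = point G'.
Proof.
rewrite Hmap_class; congr hclass; apply: val_inj; rewrite /= chain_mapU.
by congr << _ >>; apply: val_inj.
Qed.

Lemma hprod_point m n (q : quadref m) (q' : quadref n) :
  point (Stab q) ∙ point (Stab q') = point (Stab (qsum q q')).
Proof. by rewrite /hprod aug_point mulr1z Hmap_point. Qed.

Lemma hprod_H1class m n (q : quadref m) (q' : quadref n) (g : Stab q) :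
  H1class g ∙ point (Stab q') = H1class (stabl q' g).
Proof. by rewrite /hprod aug_point mulr1z Hmap_H1class. Qed.

Lemma Q1_point n (q : quadref n) : Q1 (point (Stab q)) = H1class (swap q).
Proof. by rewrite /Q1 aug_point mulr1z. Qed.

Lemma funmx_stabl m n (f : nat -> nat -> int) :
  block_mx (funmx m m f) 0 0 1%:M = funmx (m + n) (m + n) (fblock m f fid).
Proof. by rewrite (funmx1 n) funmx_block. Qed.

Lemma H1char_same_cyclic n (q0 q1 q : quadref n) (B : qiso q1 q0) (K : Stab q0 -> 'Z_4)
    (g : Stab q1) (u : Hgrp 1 (Stab q)) :
  H1char K -> odd4 (K (stab_conj B g)) -> H1class g =~ u -> cyclic_on 4 u.
Proof.
move=> HK o [C <-]; rewrite Hmap_H1class.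
have := H1char_conj (qiso_comp (qiso_inv C) B) HK => HKq.
apply: (H1char_cyclic HKq); move: o; congr odd4; congr K; apply: val_inj => /=.
rewrite invmx_mul ?unitmx_inv ?qiso_unit // invmxK !mulmxA.
by rewrite mulmxKV ?qiso_unit // mulmxKV ?qiso_unit.
Qed.

Local Notation frot := (f2 0 (-1) 1 0).
Local Notation fshear := (f2 1 1 0 1).

(** Two planes with q e = q f = q e' = q f' = 1 have the hyperbolic basis formed
by e + e', f - f' and the dual vectors f + e + e', e' + f - f'; c101 and d101 are
the coordinates in this basis on planes 0 and 2. *)
Definition c101 := lfun [:: [:: 1; -1; 0; 0; 0; -1]; [:: 0; 0; 1; 0; 0; 0]; [:: 1; 0; 0; 0; -1; -1]].
Definition d101 := lfun [:: [:: 0; 1; 0; 0; 0; 1]; [:: 0; 0; 0; 1; 0; 0]; [:: -1; 0; 0; 0; 1; 0]].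
(** A plane with q e = q f = 1 is not hyperbolic, but it embeds in two
hyperbolic planes by e = c1 + d1 and f = d1 + c2 + d2. *)
Definition c001 := lfun [:: [:: 1; 0; 0; 0; 0; 0]; [:: 0; 0; 1; 0; 0; 0];
   [:: 0; 0; 0; 0; 1; 0]; [:: 0; 0; 0; 0; 0; 1]].
Definition d001 := lfun [:: [:: 0; 1; 0; 0; 0; 0]; [:: 0; 0; 0; 1; 0; 0];
   [:: 0; 0; 0; 0; 1; 1]; [:: 0; 0; 0; 0; 0; 1]].

Lemma check101 : chart_check 3 c101 d101 true. Proof. by vm_compute. Qed.
Lemma check001 : chart_check 4 c001 d001 false. Proof. by vm_compute. Qed.

(** Isometries to the base forms, with values 1, 0, 1 or 0, 0, 1 on the basis
vectors of the three planes.  Their names give the bracketing of the source, l or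
r, and its values on the three planes. *)
Definition mx_r000 := lfun [:: [:: 0; 0; 1; 1; 0; 0]; [:: 0; 0; 0; 1; 1; 1]; [:: 1; 0; 0; 0; 0; 0];
  [:: 0; 1; 0; 0; 0; 0]; [:: 0; 0; 1; 1; 0; 1]; [:: 0; 0; 0; 0; -1; -1]].
Definition mx_l000 := lfun [:: [:: 1; 1; 0; 0; 0; 0]; [:: 0; 1; 1; 1; 0; 0]; [:: 0; 0; 0; 0; 1; 0];
  [:: 0; 0; 0; 0; 0; 1]; [:: 1; 1; 0; 1; 0; 0]; [:: 0; 0; -1; -1; 0; 0]].
Definition mx_l110 := lfun [:: [:: 1; 0; 0; 0; 0; 0]; [:: 0; 1; 0; 0; 0; 0]; [:: 0; 0; 0; 0; 1; 0];
  [:: 0; 0; 0; 0; 0; 1]; [:: 0; 0; 1; 0; 0; 0]; [:: 0; 0; 0; 1; 0; 0]].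
(** The exchange of planes 0 and 1 brings lambda to the plane treated in
chart. *)
Definition mx_l001 := lfun [:: [:: 0; 0; 1; 0; 0; 0]; [:: 0; 0; 0; 1; 0; 0]; [:: 1; 0; 0; 0; 0; 0];
  [:: 0; 1; 0; 0; 0; 0]; [:: 0; 0; 0; 0; 1; 0]; [:: 0; 0; 0; 0; 0; 1]].
Definition mx_l111 := lfun [:: [:: 1; -1; 0; -1; 0; 0]; [:: 0; 1; 0; 1; 0; 0]; [:: 1; 0; -1; -1; 0; 0];
  [:: -1; 0; 1; 0; 0; 0]; [:: 0; 0; 0; 0; 1; 0]; [:: 0; 0; 0; 0; 0; 1]].
Definition mx_r100 := lfun [:: [:: 0; 0; 1; 0; 0; 0]; [:: 0; 0; 0; 1; 0; 0]; [:: 0; 0; 0; 0; 1; 0];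
  [:: 0; 0; 0; 0; 0; 1]; [:: 1; 0; 0; 0; 0; 0]; [:: 0; 1; 0; 0; 0; 0]].

Lemma check_r000 : iso_check false false false true false true mx_r000. Proof. by vm_compute. Qed.
Lemma check_l000 : iso_check false false false true false true mx_l000. Proof. by vm_compute. Qed.
Lemma check_l110 : iso_check true true false true false true mx_l110. Proof. by vm_compute. Qed.
Lemma check_l001 : iso_check false false true false false true mx_l001. Proof. by vm_compute. Qed.
Lemma check_l001_id : iso_check false false true false false true fid. Proof. by vm_compute. Qed.
Lemma check_l111 : iso_check true true true false false true mx_l111. Proof. by vm_compute. Qed.
Lemma check_r100 : iso_check true false false false false true mx_r100. Proof. by vm_compute. Qed.

Local Notation ql a b c := (qsum (qsum (qstd a) (qstd b)) (qstd c) : quadref 6).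
Local Notation qr a b c := (qsum (qstd a) (qsum (qstd b) (qstd c)) : quadref 6).

Definition iso_r000 : qiso (qr 0 0 0) (ql 1 0 1) := iso (qsum_rE 0 0 0) (qsum_lE 1 0 1) check_r000.
Definition iso_l000 : qiso (ql 0 0 0) (ql 1 0 1) := iso (qsum_lE 0 0 0) (qsum_lE 1 0 1) check_l000.
Definition iso_l110 : qiso (ql 1 1 0) (ql 1 0 1) := iso (qsum_lE 1 1 0) (qsum_lE 1 0 1) check_l110.
Definition iso_l001 : qiso (ql 0 0 1) (ql 0 0 1) := iso (qsum_lE 0 0 1) (qsum_lE 0 0 1) check_l001.
Definition iso_l001_id : qiso (ql 0 0 1) (ql 0 0 1) :=
  iso (qsum_lE 0 0 1) (qsum_lE 0 0 1) check_l001_id.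
Definition iso_l111 : qiso (ql 1 1 1) (ql 0 0 1) := iso (qsum_lE 1 1 1) (qsum_lE 0 0 1) check_l111.
Definition iso_r100 : qiso (qr 1 0 0) (ql 0 0 1) := iso (qsum_rE 1 0 0) (qsum_lE 0 0 1) check_r100.

Definition fswap4 := fblock 4 (fswap 2) fid.
Lemma swap_l000 : swap_check 3 c101 d101 (fconj mx_l000 fswap4). Proof. by vm_compute. Qed.
Lemma swap_l110 : swap_check 3 c101 d101 (fconj mx_l110 fswap4). Proof. by vm_compute. Qed.
Lemma swap_l001_id : swap_check 4 c001 d001 (fconj fid fswap4). Proof. by vm_compute. Qed.
Lemma swap_l111 : swap_check 4 c001 d001 (fconj mx_l111 fswap4). Proof. by vm_compute. Qed.

Lemma stab_conj_funmx (q q' : quadref 6) a b c a' b' c' f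
    (hq : forall x, q x = (bquad3 a b c (bits x))%:R)
    (hq' : forall x, q' x = (bquad3 a' b' c' (bits x))%:R)
    (ck : iso_check a b c a' b' c' f) (g : Stab q) g' h :
  (g : 'M_6) = funmx 6 6 g' ->
  all (fun i => all (fun j => fconj f g' i j == h i j) (iota 0 6)) (iota 0 6) ->
  (stab_conj (iso hq hq' ck) g : 'M_6) = funmx 6 6 h.
Proof. by move=> gE /funmx_eq <-; rewrite -(funmx_conj ck) -gE. Qed.

Definition lambda_stab_r : Stab (qr 0 0 0) := stabl (qsum (qstd 0) (qstd 0)) (MkStab rot_subproof).
Definition lambda_stab_l : Stab (ql 0 0 1) := stabl (qstd 1) (stabl (qstd 0) (MkStab rot_subproof)).
Definition shear_stab_r : Stab (qr 1 0 0) := stabl (qsum (qstd 0) (qstd 0)) (MkStab shear_subproof).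
Definition swap_stab a c : Stab (ql a a c) := stabl (qstd c) (swap (qstd a)).

Lemma lambda_stab_rE : (lambda_stab_r : 'M_6) = funmx 6 6 (fblock 2 frot fid).
Proof. by rewrite -(@funmx_stabl 2 4) -funmx_mx2. Qed.
Lemma lambda_stab_lE : (lambda_stab_l : 'M_6) = funmx 6 6 (fblock 4 (fblock 2 frot fid) fid).
Proof. by rewrite -(@funmx_stabl 4 2) -(@funmx_stabl 2 2) -funmx_mx2. Qed.
Lemma shear_stab_rE : (shear_stab_r : 'M_6) = funmx 6 6 (fblock 2 fshear fid).
Proof. by rewrite -(@funmx_stabl 2 4) -funmx_mx2. Qed.
Lemma swap_stabE a c : (swap_stab a c : 'M_6) = funmx 6 6 fswap4.
Proof. by rewrite -(@funmx_stabl 4 2) -(@funmx_swap 2). Qed.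

Lemma lambda_r : lambda ∙ (sigma 0 ∙ sigma 0) = H1class lambda_stab_r.
Proof. by rewrite /sigma hprod_point hprod_H1class. Qed.
Lemma lambda_l : lambda ∙ sigma 0 ∙ sigma 1 = H1class lambda_stab_l.
Proof. by rewrite /sigma !hprod_H1class. Qed.
Lemma t'_r : t' ∙ (sigma 0 ∙ sigma 0) = H1class shear_stab_r.
Proof. by rewrite /sigma hprod_point hprod_H1class. Qed.
Lemma Q1_l a c : Q1 (sigma a) ∙ sigma c = H1class (swap_stab a c).
Proof. by rewrite /sigma Q1_point hprod_H1class. Qed.

Theorem theorem7p8 :
  [/\
    forall (q : quadref 6) (u : Hgrp 1 (Stab q)), Arf q = 0 ->
      lambda ∙ (sigma 0 ∙ sigma 0) =~ u -> cyclic_on 4 u,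
    Q1 (sigma 0) ∙ sigma 0 =~ (lambda ∙ (sigma 0 ∙ sigma 0)) *+ 2,
    [/\ Q1 (sigma 0) ∙ sigma 0 =~ Q1 (sigma 1) ∙ sigma 0,
        Q1 (sigma 0) ∙ sigma 1 =~ Q1 (sigma 1) ∙ sigma 1
      & Q1 (sigma 1) ∙ sigma 1 =~ (lambda ∙ sigma 0 ∙ sigma 1) *+ 2]
  & (forall (q : quadref 6) (u : Hgrp 1 (Stab q)), Arf q = 1 ->
      lambda ∙ sigma 0 ∙ sigma 1 =~ u -> cyclic_on 4 u) /\
    lambda ∙ sigma 0 ∙ sigma 1 =~ - (t' ∙ (sigma 0 ∙ sigma 0))
  ].
Proof.
have h101 x : (ql 1 0 1) x = (bquad true (bits x))%:R by rewrite qsum_lE bquad_bquad3.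
have h001 x : (ql 0 0 1) x = (bquad false (bits x))%:R by rewrite qsum_lE bquad_bquad3.
have [K [HK KL _ Ksw]] := chart h101 check101.
have [K' [HK' KL' KS' Ksw']] := chart h001 check001.
have Ka : K (stab_conj iso_r000 lambda_stab_r) = 1.
  by apply: KL; apply: (stab_conj_funmx _ _ _ lambda_stab_rE); vm_compute.
have Kb : K (stab_conj iso_l000 (swap_stab 0 0)) = 2.
  by apply: (Ksw _ _ _ swap_l000); rewrite -(funmx_conj check_l000) -(swap_stabE 0 0).
have Kc : K (stab_conj iso_l110 (swap_stab 1 0)) = 2.
  by apply: (Ksw _ _ _ swap_l110); rewrite -(funmx_conj check_l110) -(swap_stabE 1 0).
have Kd : K' (stab_conj iso_l001 lambda_stab_l) = 1.
  by apply: KL'; apply: (stab_conj_funmx _ _ _ lambda_stab_lE); vm_compute.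
have Ke : K' (stab_conj iso_l001_id (swap_stab 0 1)) = 2.
  by apply: (Ksw' _ _ _ swap_l001_id); rewrite -(funmx_conj check_l001_id) -(swap_stabE 0 1).
have Kf : K' (stab_conj iso_l111 (swap_stab 1 1)) = 2.
  by apply: (Ksw' _ _ _ swap_l111); rewrite -(funmx_conj check_l111) -(swap_stabE 1 1).
have Kg : K' (stab_conj iso_r100 shear_stab_r) = -1.
  by apply: KS'; apply: (stab_conj_funmx _ _ _ shear_stab_rE); vm_compute.
rewrite !Q1_l lambda_r lambda_l t'_r; split.
- move=> q u _; apply: (H1char_same_cyclic (B := iso_r000) HK).
  by rewrite Ka.
- rewrite pmulrn; apply: (same_class_H1char (B1 := iso_l000) (B2 := iso_r000) HK).
  by rewrite Kb Ka.
- split.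
  + rewrite -[X in _ =~ X]mulr1z; apply: (same_class_H1char (B1 := iso_l000) (B2 := iso_l110) HK).
    by rewrite Kb Kc.
  + rewrite -[X in _ =~ X]mulr1z;
    apply: (same_class_H1char (B1 := iso_l001_id) (B2 := iso_l111) HK').
    by rewrite Ke Kf.
  rewrite pmulrn; apply: (same_class_H1char (B1 := iso_l111) (B2 := iso_l001) HK').
  by rewrite Kf Kd.
split.
- move=> q u _; apply: (H1char_same_cyclic (B := iso_l001) HK').
  by rewrite Kd.
rewrite -mulrN1z; apply: (same_class_H1char (B1 := iso_l001) (B2 := iso_r100) HK').
by rewrite Kd Kg mulrN1z opprK.
Qed.
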